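(* Let $n\ge1$ and for each $k\geq 0$ let $\mathfrak A(2k)$ be a system of representatives of the isomorphism classes of $2k$-dimensional nilpotent symplectic Lie algebras. The set of isomorphism classes of non-abelian nilpotent $2n$-dimensional symplectic Lie algebras is in one-to-one correspondence with the set $$\coprod_{m=1}^n\ \coprod_{[\mathfrak a,\omega_{\mathfrak a}]\in\mathfrak A(2n-2m)}H^2(\mathbb R^m,\mathfrak a,\omega_{\mathfrak a})_0/G,$$ where the orbit of $[\gamma,\epsilon,\xi]\in H^2(\mathbb R^m,\mathfrak a,\omega_{\mathfrak a})_0$ corresponds to the isomorphism class of $\mathfrak d_{\gamma,\epsilon,\xi}(\mathbb R^m,\mathfrak a)$.
   Context: All vector spaces and Lie algebras are real and finite-dimensional. A symplectic Lie algebra $(\mathfrak g,\omega)$ is a Lie algebra $\mathfrak g$ with a skew-symmetric non-degenerate bilinear form $\omega$ such that $\omega([X,Y],Z)+\omega([Y,Z],X)+\omega([Z,X],Y)=0$ for all $X,Y,Z$. An isomorphism of symplectic Lie algebras is a Lie algebra isomorphism $\varphi$ with $\varphi^*\omega_2=\omega_1$. Let $\mathfrak l$ be an abelian Lie algebra (e.g. $\mathbb R^m$) and $(\mathfrak a,\omega_{\mathfrak a})$ symplectic. Let $\gamma:\mathfrak l\to\operatorname{Hom}(\mathfrak a,\mathfrak l^* )$ and $\xi:\mathfrak l\to\operatorname{Hom}(\mathfrak a,\mathfrak a)$ be linear and $\epsilon:\mathfrak l\times\mathfrak l\to\mathfrak l^*$ alternating bilinear. Write $\gamma(L_1,A,L_2):=(\gamma(L_1)(A))(L_2)$.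 Define alternating bilinear maps $\alpha:\mathfrak l\times\mathfrak l\to\mathfrak a$, $\beta:\mathfrak a\times\mathfrak a\to\mathfrak l^*$ by $$\omega_{\mathfrak a}(\alpha(L_1,L_2),A)=\gamma(L_1,A,L_2)-\gamma(L_2,A,L_1),\qquad \beta(A_1,A_2)(L)=-\omega_{\mathfrak a}(\xi(L)A_1,A_2)-\omega_{\mathfrak a}(A_1,\xi(L)A_2).$$ $Z^2(\mathfrak l,\mathfrak a,\omega_{\mathfrak a})$ is the set of such triples with, for all $L,L_i\in\mathfrak l$, $A,A_i\in\mathfrak a$: (1) every $\xi(L)$ is a derivation of $\mathfrak a$, $\xi(L_1)\xi(L_2)-\xi(L_2)\xi(L_1)=\operatorname{ad}_{\mathfrak a}(\alpha(L_1,L_2))$, and $\xi(L_1)\alpha(L_2,L_3)+\xi(L_2)\alpha(L_3,L_1)+\xi(L_3)\alpha(L_1,L_2)=0$; (2) $\beta(\xi(L)A_1,A_2)+\beta(A_1,\xi(L)A_2)=\gamma(L)[A_1,A_2]_{\mathfrak a}$; (3) $\gamma(L_2)(\xi(L_1)A)-\gamma(L_1)(\xi(L_2)A)+\beta(\alpha(L_1,L_2),A)=0$; (4) $\gamma(L_1)\alpha(L_2,L_3)+\gamma(L_2)\alpha(L_3,L_1)+\gamma(L_3)\alpha(L_1,L_2)=0$; (5) $\epsilon(L_1,L_2)L_3+\epsilon(L_2,L_3)L_1+\epsilon(L_3,L_1)L_2=0$. For $(\gamma,\epsilon,\xi)\in Z^2(\mathfrak l,\mathfrak a,\omega_{\mathfrak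 a})$, $\mathfrak d_{\gamma,\epsilon,\xi}(\mathfrak l,\mathfrak a)$ is the symplectic Lie algebra $\mathfrak l^*\oplus\mathfrak a\oplus\mathfrak l$ with brackets $[\mathfrak l^*,\cdot]=0$, $[A_1,A_2]=\beta(A_1,A_2)+[A_1,A_2]_{\mathfrak a}$, $[L,A]=\gamma(L)A+\xi(L)A$, $[L_1,L_2]=\epsilon(L_1,L_2)+\alpha(L_1,L_2)$ and form $\omega(Z_1+A_1+L_1,Z_2+A_2+L_2)=Z_1(L_2)+\omega_{\mathfrak a}(A_1,A_2)-Z_2(L_1)$. $Z^2(\mathfrak l,\mathfrak a,\omega_{\mathfrak a})_\sharp$ is the set of $(\gamma,\epsilon,\xi)\in Z^2(\mathfrak l,\mathfrak a,\omega_{\mathfrak a})$ such that (a) $L=0$ is the only $L\in\mathfrak l$ for which there is an $A\in\mathfrak a$ satisfying simultaneously $\operatorname{ad}_{\mathfrak a}(A)+\xi(L)=0$, $\gamma(L)+\beta(A,\cdot)=0$, $\alpha(L,L')=\xi(L')A$ and $\epsilon(L,L')=\gamma(L')A$ for all $L'\in\mathfrak l$; (b) the subspace $\{A\in\mathfrak z(\mathfrak a): \beta(A,\cdot)=0,\ \xi(L)A=0,\ \gamma(L)A=0\ \forall L\in\mathfrak l\}$ of $\mathfrak a$ is non-degenerate with respect to $\omega_{\mathfrak a}$ (the zero subspace counts as non-degenerate). For nilpotent $\mathfrak a$, $Z^2(\mathfrak l,\mathfrak a,\omega_{\mathfrak a})_0\subset Z^2(\mathfrak l,\mathfrak a,\omega_{\mathfrak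 a})_\sharp$ is the set of those $(\gamma,\epsilon,\xi)$ for which there is an $N\ge1$ with $\xi(L_1)\cdots\xi(L_N)=0$ for all $L_1,\dots,L_N\in\mathfrak l$ (nilpotent cocycles). The additive group $C^1(\mathfrak l,\mathfrak a)=\operatorname{Hom}(\mathfrak l,\mathfrak a)$ acts on triples by $(\gamma,\epsilon,\xi)\tau=(\gamma',\epsilon',\xi')$, where, with $\tau^*:\mathfrak a\to\mathfrak l^*$, $\tau^*(A)(L)=\omega_{\mathfrak a}(\tau L,A)$, $\xi'(L)A=\xi(L)A-[\tau L,A]_{\mathfrak a}$, $\gamma'(L)A=\gamma(L)A+\tau^*(\xi(L)A)-\tau^*([\tau L,A]_{\mathfrak a})-\beta(\tau L,A)$, $\epsilon'(L_1,L_2)=\epsilon(L_1,L_2)+\tau^*(\alpha(L_1,L_2))-\gamma(L_1)(\tau L_2)+\gamma(L_2)(\tau L_1)-\tau^*(\xi(L_1)\tau L_2-\xi(L_2)\tau L_1)+\tau^*([\tau L_1,\tau L_2]_{\mathfrak a})+\beta(\tau L_1,\tau L_2)$. $H^2(\mathfrak l,\mathfrak a,\omega_{\mathfrak a})_\sharp=Z^2(\mathfrak l,\mathfrak a,\omega_{\mathfrak a})_\sharp/C^1(\mathfrak l,\mathfrak a)$, and $H^2(\mathfrak l,\mathfrak a,\omega_{\mathfrak a})_0$ is its subset of classes $[\gamma,\epsilon,\xi]$ of nilpotent cocycles. $G=G(\mathfrak l,\mathfrak a,\omega_{\mathfrak a})$ is the set of pairs $(S,U)$ with $S$ an automorphism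 of the vector space $\mathfrak l$ and $U$ an automorphism of the symplectic Lie algebra $(\mathfrak a,\omega_{\mathfrak a})$. It acts on these cohomology sets by $(S,U)^*[\gamma,\epsilon,\xi]=[\gamma'',\epsilon'',\xi'']$ with $\gamma''(L)A=S^*(\gamma(SL)(U^{-1}A))$, $\epsilon''(L_1,L_2)=S^*(\epsilon(SL_1,SL_2))$, $\xi''(L)A=U\xi(SL)U^{-1}A$, where $S^*:\mathfrak l^*\to\mathfrak l^*$ is the transpose of $S$. $H^2(\cdot)_0/G$ is the set of orbits. *)

(* Defs.v *)
From HB Require Import structures.
From mathcomp Require Import all_boot all_order all_algebra.
From mathcomp Require Import boolp classical_sets functions reals.
From mathcomp Require Import ring lra.

Set Implicit Arguments.
Unset Strict Implicit.
Unset Printing Implicit Defensive.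

Import GRing.Theory Num.Theory.

Local Open Scope ring_scope.
Local Open Scope classical_set_scope.

Lemma linfun_linE (R : realType) (U V : vectType R) (f : U -> V) :
  linear f -> linfun f =1 f.
Proof.
move=> lf.
pose F : {linear U -> V} := HB.pack f (GRing.isLinear.Build R U V _ f lf).
exact: (lfunE F).
Qed.

Record lieAlg (R : realType) := LieAlg {
  lie_car :> vectType R;
  br : {bilinear lie_car -> lie_car -> lie_car};
  br_alt : forall x, br x x = 0;
  br_jacobi : forall x y z, br x (br y z) + br y (br z x) + br z (br x y) = 0 }.
Arguments br {R g} : rename.

Record sympLie (R : realType) := SympLie {
  symp_lie :> lieAlg R;
  omega : {biscalar symp_lie};
  omega_skew : forall x y, omega x y = - omega y x;
  omega_nondeg : forall x, (forall y, omega x y = 0) -> x = 0;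
  omega_closed : forall x y z,
    omega (br x y) z + omega (br y z) x + omega (br z x) y = 0 }.
Arguments omega {R g} : rename.

Section LieNotions.
Variable R : realType.
Implicit Types g h : sympLie R.

Definition center (g : lieAlg R) : set g := [set x | forall y, br x y = 0].

Definition abelian (g : lieAlg R) : Prop := forall x y : g, br x y = 0.

Fixpoint lower_central (g : lieAlg R) (k : nat) : {vspace g} :=
  if k is k'.+1 then
    <<[seq br x y | x <- vbasis {:g}, y <- vbasis (lower_central g k')]>>%VS
  else fullv.

Definition nilpotent (g : lieAlg R) : Prop :=
  exists k, lower_central g k = 0%VS.

Definition symp_iso g h (phi : 'Hom(g, h)) : Prop :=
  [/\ bijective phi,
      forall x y, phi (br x y) = br (phi x) (phi y) &
      forall x y, omega (phi x) (phi y) = omega x y].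

Definition isomorphic g h : Prop := exists phi : 'Hom(g, h), symp_iso phi.

(* Collections of symplectic Lie algebras are Prop-valued predicates: for     *)
(* universe reasons [set] cannot be applied to [sympLie R].                   *)
Definition iso_class g : sympLie R -> Prop := fun h => isomorphic g h.

Definition nilp_symp (d : nat) (g : sympLie R) : Prop :=
  nilpotent g /\ \dim {:g} = d.

Definition nonabelian_nilp_class (d : nat) (C : sympLie R -> Prop) : Prop :=
  exists g, [/\ nilp_symp d g, ~ abelian g & C = iso_class g].

Definition representatives (d : nat) (A : sympLie R -> Prop) : Prop :=
  (forall g, A g -> nilp_symp d g) /\
  (forall g, nilp_symp d g -> exists! a, A a /\ isomorphic g a).

End LieNotions.

Notation dual l := 'Hom(l, _^o).

Section Cohomology.
Variables (R : realType) (l : vectType R) (a : sympLie R).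

(* Linearity of gam, eps and xi, and eps being alternating, are part of Z2.   *)
Record triple := Triple {
  gam : l -> a -> dual l;
  eps : l -> l -> dual l;
  xi  : l -> a -> a }.

Implicit Types (z : triple) (tau : 'Hom(l, a)).

(* The vector determined by its pairings with all A through the nondegenerate *)
(* form omega; it exists as soon as gam is bilinear (lemma alphaE).           *)
Definition alpha z (L1 L2 : l) : a :=
  xget 0 [set v : a | forall A, omega v A = gam z L1 A L2 - gam z L2 A L1].

(* [linfun f] is f itself, seen as an element of 'Hom, when f is linear       *)
(* (see lemmas betaE and tau_starE).                                          *)
Definition beta z (A1 A2 : a) : dual l :=
  linfun (fun L => - omega (xi z L A1) A2 - omega A1 (xi z L A2) : R^o).

Record Z2 z : Prop := IsZ2 {
  Z2_gam_bilin : bilinear_for *:%R *:%R (gam z);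
  Z2_eps_bilin : bilinear_for *:%R *:%R (eps z);
  Z2_xi_bilin : bilinear_for *:%R *:%R (xi z);
  Z2_eps_alt : forall L, eps z L L = 0;
  Z2_xi_der : forall L A1 A2,
    xi z L (br A1 A2) = br (xi z L A1) A2 + br A1 (xi z L A2);
  Z2_xi_comm : forall L1 L2 A,
    xi z L1 (xi z L2 A) - xi z L2 (xi z L1 A) = br (alpha z L1 L2) A;
  Z2_xi_alpha : forall L1 L2 L3,
    xi z L1 (alpha z L2 L3) + xi z L2 (alpha z L3 L1)
      + xi z L3 (alpha z L1 L2) = 0;
  Z2_beta_xi : forall L A1 A2,
    beta z (xi z L A1) A2 + beta z A1 (xi z L A2) = gam z L (br A1 A2);
  Z2_gam_xi : forall L1 L2 A,
    gam z L2 (xi z L1 A) - gam z L1 (xi z L2 A) + beta z (alpha z L1 L2) A = 0;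
  Z2_gam_alpha : forall L1 L2 L3,
    gam z L1 (alpha z L2 L3) + gam z L2 (alpha z L3 L1)
      + gam z L3 (alpha z L1 L2) = 0;
  Z2_eps_cyclic : forall L1 L2 L3,
    eps z L1 L2 L3 + eps z L2 L3 L1 + eps z L3 L1 L2 = 0 }.

Definition central_part z : set a :=
  [set A | [/\ center A, forall B, beta z A B = 0,
               forall L, xi z L A = 0 & forall L, gam z L A = 0]].

Definition nondegenerate_on (W : set a) : Prop :=
  forall A, W A -> (forall B, W B -> omega A B = 0) -> A = 0.

Definition Z2_sharp : set triple :=
  [set z | [/\ Z2 z,
     forall L, (exists A, [/\ forall B, br A B + xi z L B = 0,
                  forall B, gam z L B + beta z A B = 0,
                  forall L', alpha z L L' = xi z L' A &
                  forall L', eps z L L' = gam z L' A]) -> L = 0 &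
     nondegenerate_on (central_part z)]].

Definition Z2_nil : set triple :=
  [set z | Z2_sharp z /\
     exists2 N, (1 <= N)%N &
       forall (s : N.-tuple l) (A : a), foldr (xi z) A s = 0].

Definition tau_star tau (A : a) : dual l :=
  linfun (fun L => omega (tau L) A : R^o).

Definition coact z tau : triple :=
  let ts := tau_star tau in
  {| gam := fun L A =>
       gam z L A + ts (xi z L A) - ts (br (tau L) A) - beta z (tau L) A;
     eps := fun L1 L2 =>
       eps z L1 L2 + ts (alpha z L1 L2) - gam z L1 (tau L2) + gam z L2 (tau L1)
       - ts (xi z L1 (tau L2) - xi z L2 (tau L1))
       + ts (br (tau L1) (tau L2)) + beta z (tau L1) (tau L2);
     xi := fun L A => xi z L A - br (tau L) A |}.

Definition H2_class z : set triple := [set coact z tau | tau in setT].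

Definition H2_nil : set (set triple) := H2_class @` Z2_nil.

Definition inG (S : 'End(l)) (U : 'End(a)) : Prop := bijective S /\ symp_iso U.

(* The transpose of S is precomposition with S.                               *)
Definition gact (S : 'End(l)) (U : 'End(a)) z : triple :=
  {| gam := fun L A => (gam z (S L) ((U^-1)%VF A) \o S)%VF;
     eps := fun L1 L2 => (eps z (S L1) (S L2) \o S)%VF;
     xi := fun L A => U (xi z (S L) ((U^-1)%VF A)) |}.

(* The orbit of the class c consists of the classes of gact S U z, where z is *)
(* a representative of c.                                                     *)
Definition G_orbit (c : set triple) : set (set triple) :=
  [set c' | exists S U z, [/\ inG S U, c z & c' = H2_class (gact S U z)]].

Definition H2_nil_mod_G : set (set (set triple)) := G_orbit @` H2_nil.

Lemma omega_inj (x y : a) : (forall w, omega x w = omega y w) -> x = y.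
Proof.
move=> xy; apply/eqP; rewrite -subr_eq0; apply/eqP.
by apply: omega_nondeg => w; rewrite linearBl /= xy subrr.
Qed.

Lemma omega_surj (f : dual a) : exists v, forall A, omega v A = f A.
Proof.
pose flat_fun (v : a) : dual a := linfun (fun A => omega v A : R^o).
have flatE v A : flat_fun v A = omega v A.
  by rewrite linfun_linE // => k x y; rewrite linearPr.
pose flat : 'Hom(a, dual a) := linfun flat_fun.
have flatE' v A : flat v A = omega v A.
  rewrite linfun_linE ?flatE // => k x y; apply/lfunP => w.
  by rewrite add_lfunE scale_lfunE !flatE linearPl.
have : f \in limg flat.
  suff -> : limg flat = fullv by rewrite memvf.
  apply/eqP; rewrite eqEdim subvf /= limg_dim_eq.
    by rewrite !dimvf /dim /= /dim /= muln1.
  apply/eqP; suff /eqP -> : lker flat == 0%VS by rewrite capv0.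
  by apply/lker0P => x y xy; apply: omega_inj => w; rewrite -!flatE' xy.
by case/memv_imgP => v _ ->; exists v => A; rewrite flatE'.
Qed.

Section CochainLemmas.
Variable z : triple.
Hypothesis gam_bilin : bilinear_for *:%R *:%R (gam z).
Hypothesis xi_bilin : bilinear_for *:%R *:%R (xi z).

Lemma alphaE L1 L2 A :
  omega (alpha z L1 L2) A = gam z L1 A L2 - gam z L2 A L1.
Proof.
have lin : linear (fun A => gam z L1 A L2 - gam z L2 A L1 : R^o).
  move=> k x y; rewrite !gam_bilin.2 !add_lfunE !scale_lfunE.
  by rewrite scalerBr opprD addrACA.
have [v vE] := omega_surj (linfun (fun A => gam z L1 A L2 - gam z L2 A L1)).
rewrite /alpha; case: xgetP => [_ _ -> //|] /(_ v); case => B.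
by rewrite vE linfun_linE.
Qed.

Lemma betaE A1 A2 L :
  beta z A1 A2 L = - omega (xi z L A1) A2 - omega A1 (xi z L A2).
Proof.
rewrite /beta linfun_linE // => k x y.
rewrite !xi_bilin.1 linearPl linearPr /= /GRing.scale /=; ring.
Qed.

End CochainLemmas.

Lemma tau_starE tau A L : tau_star tau A L = omega (tau L) A.
Proof.
by rewrite /tau_star linfun_linE // => k x y; rewrite linearP linearPl.
Qed.

End Cohomology.

Arguments H2_nil_mod_G {R} l a.


Lemma scaleoE (R : realType) (k : R) (x : R^o) : k *: x = k * (x : R).
Proof. by []. Qed.

Section Extension.
Variables (R : realType) (l : vectType R) (a : sympLie R).

(* (Z, A, L) stands for Z + A + L in l^* (+) a (+) l.                         *)
Definition d_car : vectType R := (dual l * a * l)%type.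

Variable z : triple l a.

Definition d_br (x y : d_car) : d_car :=
  let: (Z1, A1, L1) := x in let: (Z2, A2, L2) := y in
  (beta z A1 A2 + gam z L1 A2 - gam z L2 A1 + eps z L1 L2,
   br A1 A2 + xi z L1 A2 - xi z L2 A1 + alpha z L1 L2,
   0).

Definition d_omega (x y : d_car) : R :=
  let: (Z1, A1, L1) := x in let: (Z2, A2, L2) := y in
  Z1 L2 + omega A1 A2 - Z2 L1.

Lemma d_omega_bilin : bilinear_for *%R *%R d_omega.
Proof.
split=> -[[Z A] L] k [[Z1 A1] L1] [[Z2 A2] L2] /=;
  rewrite linearP ?linearPl ?linearPr /= add_lfunE scale_lfunE /= ?scaleoE;
  ring.
Qed.

Lemma d_omega_skew x y : d_omega x y = - d_omega y x.
Proof.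
case: x y => [[Z1 A1] L1] [[Z2 A2] L2] /=; rewrite omega_skew; ring.
Qed.

Lemma d_omega_nondeg x : (forall y, d_omega x y = 0) -> x = 0.
Proof.
case: x => [[Z A] L] x0; congr (_, _, _).
- apply/lfunP => P; have /= := x0 (0, 0, P).
  by rewrite linear0r !zero_lfunE subr0 addr0.
- apply: omega_inj => B; have /= := x0 (0, B, 0).
  by rewrite linear0 zero_lfunE linear0l subr0 add0r.
- have xZ (Z' : dual l) : Z' L = 0.
    have /= := x0 (Z', 0, 0).
    by rewrite linear0 linear0r !add0r => /eqP; rewrite oppr_eq0 => /eqP.
  rewrite (coord_vbasis (memvf L)) big1 // => i _.
  rewrite -[coord _ _ _](linfun_linE (f := coord _ i : l -> R^o)).
    by rewrite xZ scale0r.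
  by move=> k u v; rewrite linearP.
Qed.

Hypothesis zZ2 : Z2 z.

Let gamE := Z2_gam_bilin zZ2.
Let epsE := Z2_eps_bilin zZ2.
Let xiE := Z2_xi_bilin zZ2.

Let alE L1 L2 A := alphaE gamE L1 L2 A.
Let beE A1 A2 L := betaE xiE A1 A2 L.

Lemma alpha_bilin : bilinear_for *:%R *:%R (alpha z).
Proof.
split=> L k L1 L2 /=; apply: omega_inj => w; rewrite linearPl /= !alE;
  rewrite gamE.1 (linearP (gam z L w)) add_lfunE scale_lfunE /= ?scaleoE; ring.
Qed.

Lemma beta_bilin : bilinear_for *:%R *:%R (beta z).
Proof.
split=> A k A1 A2 /=; apply/lfunP => P; rewrite add_lfunE scale_lfunE !beE;
  rewrite xiE.2 ?linearPl ?linearPr /= /= ?scaleoE; ring.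
Qed.

Lemma d_br_bilin : bilinear_for *:%R *:%R d_br.
Proof.
split=> -[[Z A] L] k [[Z1 A1] L1] [[Z2 A2] L2] /=.
- rewrite beta_bilin.1 gamE.1 gamE.2 epsE.1 xiE.1 xiE.2 alpha_bilin.1 linearPl.
  congr (_, _, _); last by rewrite /= scaler0 addr0.
    by apply/lfunP => P; rewrite !(add_lfunE, scale_lfunE, opp_lfunE)
      /= ?scaleoE; ring.
  apply: omega_inj => w; rewrite !(linearDl, linearNl, linearZl) /=; ring.
- rewrite beta_bilin.2 gamE.1 gamE.2 epsE.2 xiE.1 xiE.2 alpha_bilin.2 linearPr.
  congr (_, _, _); last by rewrite /= scaler0 addr0.
    by apply/lfunP => P; rewrite !(add_lfunE, scale_lfunE, opp_lfunE)
      /= ?scaleoE; ring.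
  apply: omega_inj => w; rewrite !(linearDl, linearNl, linearZl) /=; ring.
Qed.

Lemma betaC A1 A2 : beta z A1 A2 = - beta z A2 A1.
Proof.
apply/lfunP => P; rewrite opp_lfunE !beE.
rewrite (omega_skew A2) (omega_skew _ A1); ring.
Qed.

Lemma d_br_alt x : d_br x x = 0.
Proof.
case: x => [[Z A] L] /=; congr (_, _, _).
- rewrite (Z2_eps_alt zZ2) addr0 addrK; apply/lfunP => P.
  by rewrite beE zero_lfunE (omega_skew A); ring.
- rewrite br_alt add0r subrr add0r; apply: omega_inj => w.
  by rewrite alE subrr linear0l.
Qed.

Lemma br_skew (g : lieAlg R) (x y : g) : br x y = - br y x.
Proof.
apply/eqP; rewrite -subr_eq0 opprK; apply/eqP.
by have := br_alt (x + y); rewrite linearDl /= !linearDr /= !br_alt addr0 add0r.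
Qed.

Lemma beta_closed A B C :
  beta z A (br B C) + beta z B (br C A) + beta z C (br A B) = 0.
Proof.
apply/lfunP => P; rewrite !add_lfunE zero_lfunE !beE.
have der := Z2_xi_der zZ2 P.
rewrite !der !linearDr /=.
have h1 := omega_closed (xi z P A) B C.
have h2 := omega_closed A (xi z P B) C.
have h3 := omega_closed A B (xi z P C).
have sk := @omega_skew _ a.
have bs := @br_skew a.
rewrite (bs C A) (bs C (xi z P A)) (bs (xi z P C) A) !linearNr /=.
rewrite (bs C) linearNl /= !(sk (br _ _)) in h1.
rewrite (bs C) linearNl /= !(sk (br _ _)) in h2.
rewrite (bs (xi z P C)) linearNl /= !(sk (br _ _)) in h3.
lra.
Qed.

Lemma alphaC L1 L2 : alpha z L1 L2 = - alpha z L2 L1.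
Proof. by apply: omega_inj => w; rewrite linearNl /= !alE opprB. Qed.

Lemma d_jacobi x y w :
  d_br x (d_br y w) + d_br y (d_br w x) + d_br w (d_br x y) = 0.
Proof.
have linD (U V : vectType R) (f : U -> V) (fP : linear f) u v :
  f (u + v) = f u + f v by rewrite -[u]scale1r fP !scale1r.
have lin0 (U V : vectType R) (f : U -> V) (fP : linear f) : f 0 = 0.
  by apply: (addrI (f 0)); rewrite -(linD _ _ f fP) !addr0.
have linN (U V : vectType R) (f : U -> V) (fP : linear f) u : f (- u) = - f u.
  by apply/eqP; rewrite -addr_eq0 -(linD _ _ f fP) addNr (lin0 _ _ f fP).
have xi0 A := lin0 _ _ _ (xiE.1 A); have gam0 A := lin0 _ _ _ (gamE.1 A).
have eps0 M := lin0 _ _ _ (epsE.2 M); have al0 M := lin0 _ _ _ (alpha_bilin.2 M).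
have xiD M := linD _ _ _ (xiE.2 M); have xiN M := linN _ _ _ (xiE.2 M).
have gamD M := linD _ _ _ (gamE.2 M); have gamN M := linN _ _ _ (gamE.2 M).
have beD A := linD _ _ _ (beta_bilin.2 A).
have beN A := linN _ _ _ (beta_bilin.2 A).
case: x => [[Zx A] L]; case: y => [[Zy B] M]; case: w => [[Zw C] N] /=.
congr (_, _, _); last by rewrite /= !addr0.
- rewrite /= !gam0 !eps0 !(xiD, xiN, gamD, gamN, beD, beN).
  have h1 := beta_closed A B C.
  have h2 := Z2_beta_xi zZ2 L B C.
  have h3 := Z2_beta_xi zZ2 M C A.
  have h4 := Z2_beta_xi zZ2 N A B.
  have h5 := Z2_gam_xi zZ2 M N A.
  have h6 := Z2_gam_xi zZ2 N L B.
  have h7 := Z2_gam_xi zZ2 L M C.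
  have h8 := Z2_gam_alpha zZ2 L M N.
  rewrite -h2 -h3 -h4.
  rewrite (betaC (alpha z _ _)) in h5; rewrite (betaC (alpha z _ _)) in h6.
  rewrite (betaC (alpha z _ _)) in h7.
  rewrite (betaC (xi z L B)) (betaC (xi z M C)) (betaC (xi z N A)).
  apply/lfunP => P.
  move/(congr1 (fun f : dual l => f P : R)): h1.
  move/(congr1 (fun f : dual l => f P : R)): h5.
  move/(congr1 (fun f : dual l => f P : R)): h6.
  move/(congr1 (fun f : dual l => f P : R)): h7.
  move/(congr1 (fun f : dual l => f P : R)): h8.
  rewrite !(add_lfunE, opp_lfunE, zero_lfunE); lra.
- rewrite /= !xi0 !al0 !(xiD, xiN) !(linearDr, linearNr) /=.
  have h1 := br_jacobi A B C.
  have h2 := Z2_xi_comm zZ2 M N A.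
  have h3 := Z2_xi_comm zZ2 N L B.
  have h4 := Z2_xi_comm zZ2 L M C.
  have h5 := Z2_xi_alpha zZ2 L M N.
  rewrite !(Z2_xi_der zZ2).
  rewrite (br_skew (alpha z _ _)) in h2; rewrite (br_skew (alpha z _ _)) in h3.
  rewrite (br_skew (alpha z _ _)) in h4.
  rewrite (br_skew (xi z L B)) (br_skew (xi z M C)) (br_skew (xi z N A)).
  apply: omega_inj => w.
  move/(congr1 (fun v : a => omega v w)): h1.
  move/(congr1 (fun v : a => omega v w)): h2.
  move/(congr1 (fun v : a => omega v w)): h3.
  move/(congr1 (fun v : a => omega v w)): h4.
  move/(congr1 (fun v : a => omega v w)): h5.
  rewrite !(linearDl, linearNl, linear0l) /=; lra.
Qed.

Lemma d_closed x y w :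
  d_omega (d_br x y) w + d_omega (d_br y w) x + d_omega (d_br w x) y = 0.
Proof.
case: x => [[Zx A] L]; case: y => [[Zy B] M]; case: w => [[Zw C] N] /=.
rewrite !linear0 !(add_lfunE, opp_lfunE) !beE !(linearDl, linearNl) /= !alE.
have := omega_closed A B C; have := Z2_eps_cyclic zZ2 L M N.
rewrite !(omega_skew _ (xi z _ _)); lra.
Qed.

Definition d_br_bilinear : {bilinear d_car -> d_car -> d_car} :=
  HB.pack d_br (bilinear_isBilinear.Build R d_car d_car d_car _ _ d_br d_br_bilin).

Definition d_omega_bilinear : {biscalar d_car} :=
  HB.pack d_omega
    (bilinear_isBilinear.Build R d_car d_car R _ _ d_omega d_omega_bilin).

Definition d_lieAlg : lieAlg R :=
  @LieAlg R d_car d_br_bilinear d_br_alt d_jacobi.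

Definition d_sympLie : sympLie R :=
  @SympLie R d_lieAlg d_omega_bilinear d_omega_skew d_omega_nondeg d_closed.

End Extension.

(* A d is the chosen system of representatives in dimension d; R^m is 'rV_m.  *)
Definition classification_data (R : realType) (n : nat)
    (A : nat -> sympLie R -> Prop) : Type :=
  {m : {m : nat | (1 <= m <= n)%N} &
  {a : {a : sympLie R | A (2 * n - 2 * sval m)%N a} &
   set_type (H2_nil_mod_G 'rV[R]_(sval m) (sval a))}}.

(* Main.v *)
(* A symplectic Lie algebra d_z over (l, a) determines its ideal l^* as soon as
   z is sharp: conditions (a) and (b) say that l^* is the radical of the center
   z(d_z) with respect to omega.  An isomorphism d_z -> d_z' therefore respects
   the flag l^* < l^* (+) a, and up to maps into the central ideal l^* it is the
   composition of a shear (the action of some tau) and a rescaling (the action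
   of some (S, U)); this gives injectivity.  Conversely, for g nilpotent and not
   abelian, the radical j of z(g) is nonzero, since [g, g] is orthogonal to z(g)
   and meets it nontrivially; an isotropic complement of j^perp identifies g with some d_z
   over a = j^perp / j.  That a triple obtained from such an identification is a
   cocycle only uses the Lie algebra axioms of g, so the same lemma also shows
   that both actions preserve cocycles. *)
Require Import Defs.
From HB Require Import structures.
From mathcomp Require Import all_boot all_order all_algebra.
From mathcomp Require Import boolp classical_sets functions reals.
From mathcomp Require Import ring lra.

Set Implicit Arguments.
Unset Strict Implicit.
Unset Printing Implicit Defensive.

Import GRing.Theory Num.Theory.

Local Open Scope ring_scope.
Local Open Scope classical_set_scope.

(** * Linear algebra *)

Section LinearAlgebra.
Variable R : realType.

(** Isomorphisms are never decomposed exactly. Adding central values to a linear map changes no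
    bracket of its images, so a cocycle is already determined by an identification of its model
    taken modulo such values, provided the identification is known exactly on l^* (+) a, where all
    brackets lie ([model_unique]). This is why shears, whose composition is additive only up to maps
    from l to l^*, still give an additive action on cocycles, and why an isomorphism has to be
    matched on l only modulo l^*. The maps alpha and beta are not free data: once l^* is central,
    closedness of the form recovers them from gamma and xi. Reading a transported bracket on pairs
    from a and l therefore yields a whole cocycle, and the formulas of both actions come out of this
    reading instead of being checked condition by condition. *)

Lemma lin0 (U V : vectType R) (f : U -> V) : linear f -> f 0 = 0.
Proof. by move=> lf; rewrite -(linfun_linE lf) linear0. Qed.

Lemma linN (U V : vectType R) (f : U -> V) : linear f -> {morph f : x / - x}.
Proof. by move=> lf x; rewrite -!(linfun_linE lf) linearN. Qed.

Lemma linD (U V : vectType R) (f : U -> V) : linear f -> {morph f : x y / x + y}.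
Proof. by move=> lf x y; rewrite -!(linfun_linE lf) linearD. Qed.

Lemma linear_bij (U V : vectType R) (f : 'Hom(U, V)) :
  bijective f -> cancel f (f^-1)%VF /\ cancel (f^-1)%VF f.
Proof.
move=> [g fK gK]; have fK' : cancel f (f^-1)%VF.
  by apply: lker0_lfunK; apply/lker0P; exact: can_inj fK.
by split=> // y; rewrite -[in X in f X](gK y) fK' gK.
Qed.

Lemma linear_inj_bij (U V : vectType R) (f : 'Hom(U, V)) :
  injective f -> \dim {:U} = \dim {:V} -> bijective f.
Proof.
move=> /lker0P/[dup] f0 /eqP kf0 dimUV; exists (f^-1)%VF; first exact: lker0_lfunK.
move=> y; apply: limg_lfunVK; suff -> : limg f = fullv by rewrite memvf.
by apply/eqP; rewrite eqEdim subvf /= limg_dim_eq ?dimUV // kf0 capv0.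
Qed.

Lemma linear_inj_dim (U V : vectType R) (f : 'Hom(U, V)) :
  injective f -> (\dim {:U} <= \dim {:V})%N.
Proof.
move=> /lker0P/eqP kf0; have <- : \dim (limg f) = \dim {:U}.
  by rewrite limg_dim_eq // kf0 capv0.
by rewrite dimvS ?subvf.
Qed.

Lemma dim_dual (l : vectType R) : \dim {:dual l} = \dim {:l}.
Proof. by rewrite !dimvf /dim /= /dim /= muln1. Qed.

(** A subspace of maximal dimension inside [P] absorbs every vector of [P], since adding the line
    through it stays inside. This turns predicates given by quantified equations, such as
    centrality, into subspaces. *)
Lemma submod_vspace (V : vectType R) (P : V -> Prop) :
  P 0 -> (forall k x y, P x -> P y -> P (k *: x + y)) ->
  exists W : {vspace V}, forall x, x \in W <-> P x.
Proof.
move=> P0 Plin.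
pose Q d := `[< exists W : {vspace V}, \dim W = d /\ forall x, x \in W -> P x >].
have exQ : exists d, Q d.
  by exists 0%N; apply/asboolP; exists 0%VS; split=> [|x];
    rewrite ?dimv0 // memv0 => /eqP ->.
have Qbound d : Q d -> (d <= \dim {:V})%N.
  by move=> /asboolP[W [<- _]]; rewrite dimvS ?subvf.
case: (ex_maxnP exQ Qbound) => d /asboolP[W [dimW WP]] dmax.
exists W => x; split=> [/WP //|Px].
have /dmax : Q (\dim (<[x]> + W)%VS).
  apply/asboolP; exists (<[x]> + W)%VS; split=> // y.
  by case/memv_addP => _ /vlineP[k ->] [w /WP Pw ->]; exact: Plin.
rewrite -dimW => dimle; have /eqP -> : W == (<[x]> + W)%VS.
  by rewrite eqEdim addvSr.
by rewrite (subvP (addvSl _ _)) // memv_line.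
Qed.

Lemma dual_separates (l : vectType R) (L : l) :
  (forall Z : dual l, Z L = 0) -> L = 0.
Proof.
move=> ZL; rewrite (coord_vbasis (memvf L)) big1 // => i _.
have lin : linear (coord (vbasis {:l}) i : l -> R^o) by move=> k u v; rewrite linearP.
by rewrite -[coord _ _ _](linfun_linE lin) ZL scale0r.
Qed.

End LinearAlgebra.

(** * Upper central series *)

Section UpperCentralSeries.
Variable R : realType.

(** A predicate on single vectors: the later inductions follow one element through iterated
    brackets, which the spans in [lower_central] do not allow directly. *)
Fixpoint upper_central (g : lieAlg R) (k : nat) (v : g) : Prop :=
  if k is k'.+1 then forall x, upper_central k' (br x v) else v = 0.

Variable g : lieAlg R.
Implicit Types u v x y : g.

Lemma upper_central_lin k c u v :
  upper_central k u -> upper_central k v -> upper_central k (c *: u + v).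
Proof.
elim: k u v => [|k IHk] u v /=; first by move=> -> ->; rewrite scaler0 addr0.
by move=> uk vk x; rewrite linearPr; exact: IHk.
Qed.

Lemma upper_central0 k : @upper_central g k 0.
Proof. by elim: k => //= k IHk x; rewrite linear0r. Qed.

Lemma upper_centralD k u v :
  upper_central k u -> upper_central k v -> upper_central k (u + v).
Proof. by move=> uk vk; rewrite -[u]scale1r; exact: upper_central_lin. Qed.

Lemma upper_centralN k u : upper_central k u -> upper_central k (- u).
Proof.
move=> uk; rewrite -[- u]addr0 -scaleN1r.
exact: upper_central_lin uk (upper_central0 k).
Qed.

Lemma upper_centralS k v : upper_central k v -> upper_central k.+1 v.
Proof.
elim: k v => [|k IHk] v; first by move=> /= -> x; rewrite linear0r.
by move=> vk x; apply: IHk; exact: vk.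
Qed.

Lemma lower_central_br k x y : y \in lower_central g k ->
  br x y \in lower_central g k.+1.
Proof.
move=> yk; rewrite (coord_vbasis (memvf x)) (coord_vbasis yk) linear_sumr /=.
rewrite memv_suml // => j _; rewrite br_skew linear_sumr /= memvN.
rewrite memv_suml // => i _; rewrite br_skew memvN.
rewrite linearZr linearZl /= !memvZ // memv_span //.
by apply: allpairs_f; rewrite mem_nth ?size_tuple.
Qed.

(** The two series interlace: if one of them terminates after k steps, the (k - i)-th lower term
    lies in the i-th upper term for every i <= k. *)
Lemma nilpotentP : nilpotent g <-> exists k, forall v, @upper_central g k v.
Proof.
split=> [[k gk]|[k gk]]; exists k.
  suff H i v : (i <= k)%N -> v \in lower_central g (k - i) -> upper_central i v.
    by move=> v; apply: H; rewrite ?subnn ?memvf.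
  elim: i v => [|i IHi] v ik; first by rewrite subn0 gk memv0 => /eqP.
  move=> /= vk x; apply: IHi; first exact: ltnW.
  by move/(lower_central_br x): vk; rewrite -subSn // subSS.
suff H i v : (i <= k)%N -> v \in lower_central g i -> upper_central (k - i) v.
  apply/eqP; rewrite -subv0; apply/subvP => v /(H k v (leqnn k)).
  by rewrite subnn /= => ->; rewrite mem0v.
elim: i v => [|i IHi] v ik; first by rewrite subn0.
have [W WP] := @submod_vspace _ _ (fun v : g => upper_central (k - i.+1) v)
  (@upper_central0 _) (@upper_central_lin _).
move=> vi; apply/WP; move: v vi; apply/subvP/span_subvP => u.
case/allpairsP => [[x y] /= [_ /vbasis_mem/(IHi _ (ltnW ik)) yi ->]]; apply/WP.
by move: yi; rewrite -subnSK.
Qed.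

End UpperCentralSeries.

(** * Identification with a standard model *)

Section StandardModel.
Variables (R : realType) (l : vectType R) (a : sympLie R).
Local Notation vec Z A L := ((Z, A, L) : d_car l a).

Lemma d_car_split (Z : dual l) (A : a) (L : l) :
  vec Z A L = vec Z 0 0 + vec 0 A 0 + vec 0 0 L.
Proof. by congr (_, _, _); rewrite /= ?addr0 ?add0r. Qed.

Lemma d_omega0l (x : d_car l a) : d_omega 0 x = 0.
Proof.
case: x => [[Z A] L]; rewrite -[0 in LHS]/(vec 0 0 0) /=.
by rewrite zero_lfunE linear0l linear0 subr0 addr0.
Qed.

(** The bracket pulled back along [psi] is cut into components. Centrality of l^* and closedness of
    the form fix all of them except those named gam, eps and xi, and the Lie algebra axioms become
    the cocycle conditions. *)
Lemma standard_model (g : sympLie R) (psi : 'Hom(d_car l a, g)) :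
    bijective psi -> (forall x y, omega (psi x) (psi y) = d_omega x y) ->
    (forall Z, center (psi (vec Z 0 0))) ->
    (forall A1 A2, exists Z,
       br (psi (vec 0 A1 0)) (psi (vec 0 A2 0)) = psi (vec Z (br A1 A2) 0)) ->
  exists z : triple l a,
    Z2 z /\ forall x y, psi (d_br z x y) = br (psi x) (psi y).
Proof.
move=> /linear_bij[psiK psiVK] psi_om psi_cent psi_br.
have [B BE] : exists B : {bilinear d_car l a -> d_car l a -> d_car l a},
    forall x y, psi (B x y) = br (psi x) (psi y).
  pose B0 x y : d_car l a := (psi^-1)%VF (br (psi x) (psi y)).
  have B0_bilin : bilinear_for *:%R *:%R B0.
    by split=> u k x y; rewrite /B0 /= linearP ?linearPl ?linearPr /= linearP.
  pose B : {bilinear d_car l a -> d_car l a -> d_car l a} :=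
    HB.pack B0 (bilinear_isBilinear.Build R _ _ _ _ _ B0 B0_bilin).
  by exists B => x y; rewrite [LHS]psiVK.
have psi_inj := can_inj psiK.
have Bsk x y : B x y = - B y x.
  by apply: psi_inj; rewrite linearN /= !BE br_skew.
have Bjac x y w : B x (B y w) + B y (B w x) + B w (B x y) = 0.
  by apply: psi_inj; rewrite !linearD linear0 /= !BE br_jacobi.
have Bcl x y w : d_omega (B x y) w + d_omega (B y w) x + d_omega (B w x) y = 0.
  by rewrite -!psi_om !BE omega_closed.
have Balt x : B x x = 0 by apply: psi_inj; rewrite BE linear0 br_alt.
have BZ Z y : B (vec Z 0 0) y = 0.
  by apply: psi_inj; rewrite BE linear0; exact: psi_cent.
(* Closedness against a central (Z, 0, 0) leaves only the pairing of Z with the l-component of the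
   bracket, which is therefore zero. *)
have B2 x y : (B x y).2 = 0.
  apply: dual_separates => Z; have := Bcl x y (vec Z 0 0).
  rewrite (Bsk y) !BZ oppr0 !d_omega0l !addr0.
  case: (B x y) => [[Z1 A1] L1] /=; rewrite linear0 linear0r !add0r.
  by move/eqP; rewrite oppr_eq0 => /eqP.
have Bstrip x Z A : B x (vec Z A 0) = B x (vec 0 A 0).
  by rewrite (d_car_split Z) linearDr /= linearDr /= Bsk BZ oppr0 add0r
    [B x 0]linear0r addr0.

have vecE (v : d_car l a) : v.2 = 0 -> v = vec v.1.1 v.1.2 0.
  by case: v => [[? ?] ?] /= ->.
pose z := {| gam := fun L A => (B (vec 0 0 L) (vec 0 A 0)).1.1;
             eps := fun L1 L2 => (B (vec 0 0 L1) (vec 0 0 L2)).1.1;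
             xi := fun L A => (B (vec 0 0 L) (vec 0 A 0)).1.2 |} : triple l a.
have vecL k L1 L2 : vec 0 0 (k *: L1 + L2) = k *: vec 0 0 L1 + vec 0 0 L2.
  by congr (_, _, _); rewrite /= ?scaler0 ?addr0.
have vecA k A1 A2 : vec 0 (k *: A1 + A2) 0 = k *: vec 0 A1 0 + vec 0 A2 0.
  by congr (_, _, _); rewrite /= ?scaler0 ?addr0.
have gam_bilin : bilinear_for *:%R *:%R (gam z).
  by split=> u k x y; rewrite /z /= ?vecL ?vecA ?linearPl ?linearPr.
have eps_bilin : bilinear_for *:%R *:%R (eps z).
  by split=> u k x y; rewrite /z /= ?vecL ?vecA ?linearPl ?linearPr.
have xi_bilin : bilinear_for *:%R *:%R (xi z).
  by split=> u k x y; rewrite /z /= ?vecL ?vecA ?linearPl ?linearPr.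
have BLA L A : B (vec 0 0 L) (vec 0 A 0) = vec (gam z L A) (xi z L A) 0.
  exact: vecE (B2 _ _).
have BAL L A : B (vec 0 A 0) (vec 0 0 L) = vec (- gam z L A) (- xi z L A) 0.
  by rewrite Bsk BLA; congr (_, _, _); rewrite /= oppr0.
(* [psi_br] gives the a-component only; closedness on two vectors of a and one of l forces the
   l^*-component to be [beta]. In the same way, one vector of a and two of l force [alpha] below. *)
have BAA A1 A2 : B (vec 0 A1 0) (vec 0 A2 0) = vec (beta z A1 A2) (br A1 A2) 0.
  have [Z ZE] := psi_br A1 A2.
  have {}ZE : B (vec 0 A1 0) (vec 0 A2 0) = vec Z (br A1 A2) 0.
    by apply: psi_inj; rewrite BE.
  rewrite ZE; congr (_, _, _); apply/lfunP => L; rewrite betaE //.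
  have := Bcl (vec 0 A1 0) (vec 0 A2 0) (vec 0 0 L).
  rewrite ZE BAL BLA /= !linear0 ?linear0r /= linearNl /= (omega_skew A1).
  lra.
have BLL L1 L2 : B (vec 0 0 L1) (vec 0 0 L2) = vec (eps z L1 L2) (alpha z L1 L2) 0.
  rewrite [LHS]vecE ?B2 //; congr (_, _, _); apply: omega_inj => A.
  rewrite alphaE //; have := Bcl (vec 0 0 L1) (vec 0 0 L2) (vec 0 A 0).
  rewrite BLA BAL /=; case: (B _ _) => [[Z3 A3] L3] /=.
  rewrite !linear0 ?linear0r !opp_lfunE ?zero_lfunE; lra.
(* From here on [z] is known through the bracket formulas alone, so simplification no longer unfolds
   it. *)
clearbody z.
have BLA' L Z A : B (vec 0 0 L) (vec Z A 0) = vec (gam z L A) (xi z L A) 0.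
  by rewrite Bstrip BLA.
have BAA' A1 Z A2 : B (vec 0 A1 0) (vec Z A2 0) = vec (beta z A1 A2) (br A1 A2) 0.
  by rewrite Bstrip BAA.
(* Apart from bilinearity and the alternation of eps, the cocycle conditions are the l^*- and
   a-components of the Jacobi identity on vectors of a and l; the cyclic identity of eps is
   closedness on l. *)
have Jac11 x y w := congr1 (fun v : d_car l a => v.1.1) (Bjac x y w).
have Jac12 x y w := congr1 (fun v : d_car l a => v.1.2) (Bjac x y w).
have betaN A1 A2 : beta z A1 (- A2) = - beta z A1 A2.
  apply/lfunP => L; rewrite opp_lfunE !betaE // (linN (xi_bilin.2 L)) !linearN /=.
  ring.
have betaC' A1 A2 : beta z A1 A2 = - beta z A2 A1.
  apply/lfunP => L; rewrite opp_lfunE !betaE // (omega_skew A2) (omega_skew _ A1); ring.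
exists z; split.
  split=> //.
  - by move=> L; have := BLL L L; rewrite Balt => -[].
  - move=> L A1 A2; have := Jac12 (vec 0 0 L) (vec 0 A1 0) (vec 0 A2 0).
    rewrite !(BLA', BAA', BAL) /= linearNr /= (br_skew A2) -addrA -opprD.
    by move=> /subr0_eq ->; rewrite addrC.
  - move=> L1 L2 A; have := Jac12 (vec 0 0 L1) (vec 0 0 L2) (vec 0 A 0).
    rewrite !(BLA', BAA', BAL, BLL) /= (linN (xi_bilin.2 L2)) (br_skew A).
    by move=> /subr0_eq.
  - move=> L1 L2 L3; have := Jac12 (vec 0 0 L1) (vec 0 0 L2) (vec 0 0 L3).
    by rewrite !(BLA', BAA', BAL, BLL).
  - move=> L A1 A2; have := Jac11 (vec 0 0 L) (vec 0 A1 0) (vec 0 A2 0).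
    rewrite !(BLA', BAA', BAL, BLL) /= betaN (betaC' A2) -addrA -opprD.
    by move=> /subr0_eq ->; rewrite addrC.
  - move=> L1 L2 A; have := Jac11 (vec 0 0 L1) (vec 0 0 L2) (vec 0 A 0).
    rewrite !(BLA', BAA', BAL, BLL) /= (linN (gam_bilin.2 L2)) (betaC' A).
    by move=> /subr0_eq <-; rewrite addrA subrK subrr.
  - move=> L1 L2 L3; have := Jac11 (vec 0 0 L1) (vec 0 0 L2) (vec 0 0 L3).
    by rewrite !(BLA', BAA', BAL, BLL).
  - move=> L1 L2 L3; have := Bcl (vec 0 0 L1) (vec 0 0 L2) (vec 0 0 L3).
    by rewrite !BLL /= !linear0 !addr0.
move=> [[Z1 A1] L1] [[Z2 A2] L2].
rewrite -BE; congr (psi _).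
have BZr x Z : B x (vec Z 0 0) = 0 by rewrite Bsk BZ oppr0.
rewrite [in RHS](d_car_split Z1) [in RHS](d_car_split Z2).
rewrite [RHS]linearDl [in RHS]linearDl /= [B (vec 0 A1 0) _]linearDr.
rewrite [B (vec 0 0 L1) _]linearDr /= [B (vec 0 A1 0) (_ + _)]linearDr.
rewrite [B (vec 0 0 L1) (_ + _)]linearDr /= !BZ !BZr !add0r BAA BAL BLA BLL.
by congr (_, _, _); rewrite /= ?addr0 // !addrA; congr (_ + _); rewrite addrAC.
Qed.

End StandardModel.

(** * The bracket of a cocycle model *)

Section Extensions.
Variables (R : realType) (l : vectType R) (a : sympLie R).
Local Notation vec Z A L := ((Z, A, L) : d_car l a).
Implicit Types z : triple l a.

Section Z2Values.
Variables (z : triple l a) (zZ2 : Z2 z).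

Let gamD := Z2_gam_bilin zZ2.
Let epsD := Z2_eps_bilin zZ2.
Let xiD := Z2_xi_bilin zZ2.

(** A tuple of equations acts as a multirule: one [rewrite] clears zero arguments in all components
    of the bracket. *)
Definition Z2_0E := ((fun A => lin0 (gamD.1 A), fun L => lin0 (gamD.2 L)),
  (fun A => lin0 (xiD.1 A), fun L => lin0 (xiD.2 L)),
  (fun A => lin0 (epsD.1 A), fun L => lin0 (epsD.2 L)),
  (fun A => lin0 ((alpha_bilin zZ2).1 A), fun L => lin0 ((alpha_bilin zZ2).2 L)),
  (fun A => lin0 ((beta_bilin zZ2).1 A), fun L => lin0 ((beta_bilin zZ2).2 L))).

Definition Z2_NE := ((fun A => linN (gamD.1 A), fun L => linN (gamD.2 L)),
  (fun A => linN (xiD.1 A), fun L => linN (xiD.2 L)),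
  (fun A => linN (epsD.1 A), fun L => linN (epsD.2 L)),
  (fun A => linN ((alpha_bilin zZ2).1 A), fun L => linN ((alpha_bilin zZ2).2 L)),
  (fun A => linN ((beta_bilin zZ2).1 A), fun L => linN ((beta_bilin zZ2).2 L))).

Lemma d_br_LA L A : d_br z (vec 0 0 L) (vec 0 A 0) = vec (gam z L A) (xi z L A) 0.
Proof.
rewrite /= !Z2_0E linear0l.
by congr (_, _, _); rewrite !(add0r, subr0, addr0).
Qed.

Lemma d_br_AA Z1 A1 Z2 A2 :
  d_br z (vec Z1 A1 0) (vec Z2 A2 0) = vec (beta z A1 A2) (br A1 A2) 0.
Proof. by rewrite /= !Z2_0E; congr (_, _, _); rewrite !(subr0, addr0). Qed.

Lemma d_br_LL L1 L2 :
  d_br z (vec 0 0 L1) (vec 0 0 L2) = vec (eps z L1 L2) (alpha z L1 L2) 0.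
Proof.
rewrite /= !Z2_0E linear0l.
by congr (_, _, _); rewrite !(add0r, subr0, addr0).
Qed.

Lemma d_br_center_dual Z y : d_br z (vec Z 0 0) y = 0.
Proof.
case: y => [[Z2 A2] L2]; rewrite /= !Z2_0E linear0l.
by congr (_, _, _); rewrite !(add0r, subr0, addr0).
Qed.

(** The four equations of condition (a) are the components of the brackets of A + L with a vector of
    a and with a vector of l: they say that A + L is central. *)
Lemma d_br_eq0P A L :
  (forall y, d_br z (vec 0 A L) y = 0) <->
  [/\ forall B, br A B + xi z L B = 0, forall B, gam z L B + beta z A B = 0,
      forall L', alpha z L L' = xi z L' A & forall L', eps z L L' = gam z L' A].
Proof.
split=> [H|[H1 H2 H3 H4] [[Z' B] L']].
  have HB B : beta z A B + gam z L B = 0 /\ br A B + xi z L B = 0.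
    by have := H (vec 0 B 0); rewrite /= !Z2_0E !addr0 !subr0 => -[].
  have HL L' : - gam z L' A + eps z L L' = 0 /\ - xi z L' A + alpha z L L' = 0.
    by have := H (vec 0 0 L'); rewrite /= !Z2_0E linear0r !add0r => -[].
  split=> [B|B|L'|L'].
  - by case: (HB B).
  - by rewrite addrC; case: (HB B).
  - by case: (HL L') => _; rewrite addrC => /subr0_eq.
  - by case: (HL L') => + _; rewrite addrC => /subr0_eq.
rewrite /= H1 H3 H4 [beta _ _ _ + _]addrC H2 !add0r !addNr.
by [].
Qed.

End Z2Values.

Lemma d_br_inj z1 z2 : Z2 z1 -> Z2 z2 ->
  (forall x y, d_br z1 x y = d_br z2 x y) -> z1 = z2.
Proof.
move=> zc1 zc2 br12.
have LA L A : vec _ _ _ = vec _ _ _ :=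
  etrans (etrans (esym (d_br_LA zc1 L A)) (br12 _ _)) (d_br_LA zc2 L A).
have LL L L' : vec _ _ _ = vec _ _ _ :=
  etrans (etrans (esym (d_br_LL zc1 L L')) (br12 _ _)) (d_br_LL zc2 L L').
have gam12 : gam z1 = gam z2 by apply/funext => L; apply/funext => A; case: (LA L A).
have xi12 : xi z1 = xi z2 by apply/funext => L; apply/funext => A; case: (LA L A).
have eps12 : eps z1 = eps z2 by apply/funext => L; apply/funext => A; case: (LL L A).
case: z1 z2 gam12 xi12 eps12 {zc1 zc2 br12 LA LL} => [g1 e1 x1] [g2 e2 x2] /=.
by move=> -> -> ->.
Qed.

Lemma d_br_2 z x y : (d_br z x y).2 = 0.
Proof. by case: x y => [[? ?] ?] [[? ?] ?]. Qed.

(** Central discrepancies between [phi] and [psi] disappear inside brackets, and brackets have no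
    l-component, so they land where the two maps agree. *)
Lemma model_unique z1 z2 (g : sympLie R) (phi psi : 'Hom(d_car l a, g)) :
    Z2 z1 -> Z2 z2 -> injective psi ->
    (forall x y, phi (d_br z1 x y) = br (phi x) (phi y)) ->
    (forall x y, psi (d_br z2 x y) = br (psi x) (psi y)) ->
    (forall x, x.2 = 0 -> phi x = psi x) ->
    (forall x, center (phi x - psi x)) ->
  z1 = z2.
Proof.
move=> zc1 zc2 psi_inj phiE psiE eq0 phipsi; apply: d_br_inj => // x y.
apply: psi_inj; rewrite -eq0 ?d_br_2 // phiE psiE.
have {1}-> : phi x = (phi x - psi x) + psi x by rewrite subrK.
have {1}-> : phi y = (phi y - psi y) + psi y by rewrite subrK.
by rewrite linearDl linearDr /= !phipsi !add0r linearDr /= [X in X + _ = _]br_skew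
  phipsi oppr0 add0r.
Qed.

End Extensions.

(** * Shears and rescalings *)

Section CochainAction.
Variables (R : realType) (l : vectType R) (a : sympLie R).
Local Notation vec Z A L := ((Z, A, L) : d_car l a).
Implicit Types (z : triple l a) (tau : 'Hom(l, a)).

Lemma tau_star_lin tau : linear (tau_star tau).
Proof.
move=> k A B; apply/lfunP => L.
by rewrite add_lfunE scale_lfunE !tau_starE linearPr.
Qed.

Let tau_starPl tau1 tau2 A : tau_star (tau1 + tau2) A = tau_star tau1 A + tau_star tau2 A.
Proof. by apply/lfunP => L; rewrite add_lfunE !tau_starE add_lfunE linearDl. Qed.

Let tau_starNl tau A : tau_star (- tau) A = - tau_star tau A.
Proof. by apply/lfunP => L; rewrite opp_lfunE !tau_starE opp_lfunE linearNl. Qed.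

(** This is the exponential 1 + N + N^2/2 of the nilpotent map N sending L to - tau L and A to -
    [tau_star tau A]. N is infinitesimally symplectic, which explains the coefficient 1/2, the
    invariance of the form and the inverse [shear (- tau)]. *)
Definition shear tau : 'Hom(d_car l a, d_car l a) :=
  linfun (fun x : d_car l a =>
    vec (x.1.1 - tau_star tau x.1.2 + 2^-1 *: tau_star tau (tau x.2))
        (x.1.2 - tau x.2) x.2).

Lemma shearE tau Z A L : shear tau (vec Z A L) =
  vec (Z - tau_star tau A + 2^-1 *: tau_star tau (tau L)) (A - tau L) L.
Proof.
rewrite /shear linfun_linE // => k [[Z1 A1] L1] [[Z2 A2] L2] /=.
congr (_, _, _) => /=; last by rewrite linearP opprD scalerBr addrACA.
rewrite linearP !tau_star_lin; apply/lfunP => P.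
rewrite !(add_lfunE, scale_lfunE, opp_lfunE) /= !scaleoE; ring.
Qed.

Lemma shear0E tau Z A : shear tau (vec Z A 0) = vec (Z - tau_star tau A) A 0.
Proof.
by rewrite shearE linear0 subr0 (lin0 (tau_star_lin tau)) scaler0 addr0.
Qed.

Lemma shearLE tau L :
  shear tau (vec 0 0 L) = vec (2^-1 *: tau_star tau (tau L)) (- tau L) L.
Proof. by rewrite shearE (lin0 (tau_star_lin tau)) subr0 !add0r. Qed.

Lemma shear_omega tau x y : d_omega (shear tau x) (shear tau y) = d_omega x y.
Proof.
case: x y => [[Z1 A1] L1] [[Z2 A2] L2]; rewrite !shearE /=.
rewrite !(add_lfunE, scale_lfunE, opp_lfunE) !tau_starE /= !scaleoE.
rewrite !linearDl !linearDr !linearNl !linearNr /=.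
rewrite (omega_skew A1 (tau L2)) (omega_skew (tau L2) (tau L1)); lra.
Qed.

Lemma shearK tau : cancel (shear tau) (shear (- tau)).
Proof.
move=> [[Z A] L]; rewrite !shearE opp_lfunE opprK subrK.
congr (_, _, _); rewrite !tau_starNl (linN (tau_star_lin tau)) (linD (tau_star_lin tau)).
rewrite (linN (tau_star_lin tau)).
apply/lfunP => P; rewrite !(add_lfunE, scale_lfunE, opp_lfunE) /= !scaleoE; lra.
Qed.

Lemma shear_bij tau : bijective (shear tau).
Proof.
by exists (shear (- tau)); [exact: shearK | rewrite -{2}[tau]opprK; exact: shearK].
Qed.

(** [standard_model] supplies some cocycle for the bracket transported through the shear; its values
    on [L, A] and [L1, L2] turn out to be the formulas of [coact]. The quadratic term of the shear
    is central and drops out. *)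
Lemma coactP z tau : Z2 z -> Z2 (coact z tau) /\
  forall x y, shear tau (d_br (coact z tau) x y) = d_br z (shear tau x) (shear tau y).
Proof.
move=> zZ2.
have [|Z|A1 A2|z' [z'Z2 z'E]] :=
  @standard_model R l a (d_sympLie zZ2) (shear tau) (shear_bij tau).
- exact: shear_omega.
- by move=> y; rewrite shear0E (lin0 (tau_star_lin tau)) subr0; exact: d_br_center_dual.
- exists (beta z A1 A2 + tau_star tau (br A1 A2)); rewrite !shear0E addrK.
  by rewrite /br /= !(Z2_0E zZ2) !addr0 !subr0.
have {}z'E x y : shear tau (d_br z' x y) = d_br z (shear tau x) (shear tau y) := z'E x y.
suff <- : z' = coact z tau by [].
(* The shear subtracts [tau_star] of the a-component from the l^*-component, hence the mixed
   left-hand side; the second component is substituted into the first at the end. *)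
have xi_gam L A : vec (gam z' L A - tau_star tau (xi z' L A)) (xi z' L A) 0 =
    vec (gam z L A - beta z (tau L) A) (xi z L A - br (tau L) A) 0.
  have := z'E (vec 0 0 L) (vec 0 A 0).
  rewrite (d_br_LA z'Z2) !shear0E shearLE /= !(Z2_0E zZ2, Z2_NE zZ2) linearNl => -[-> ->].
  by rewrite !(subr0, addr0) addrC [- br _ _ + _]addrC.
have eps_al L1 L2 : vec (eps z' L1 L2 - tau_star tau (alpha z' L1 L2))
                             (alpha z' L1 L2) 0 =
    vec (eps z L1 L2 - gam z L1 (tau L2) + gam z L2 (tau L1) + beta z (tau L1) (tau L2))
        (alpha z L1 L2 - (xi z L1 (tau L2) - xi z L2 (tau L1)) + br (tau L1) (tau L2)) 0.
  have := z'E (vec 0 0 L1) (vec 0 0 L2).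
  rewrite (d_br_LL z'Z2) !shear0E !shearLE /= !(Z2_0E zZ2, Z2_NE zZ2).
  rewrite linearNl linearNr /= !opprK => -[-> ->].
  congr (_, _, _).
    by apply/lfunP => P; rewrite !(add_lfunE, opp_lfunE); ring.
  by apply: omega_inj => A; rewrite !(linearDl, linearNl) /=; ring.
case: z' xi_gam eps_al {z'Z2 z'E} => g e x /= xi_gam eps_al; rewrite /coact.
have tsD := linD (tau_star_lin tau); have tsN := linN (tau_star_lin tau).
congr Triple; apply/funext => L; apply/funext => A.
- case: (xi_gam L A) => /(canRL (subrK _)) -> ->; rewrite tsD tsN.
  by apply/lfunP => P; rewrite !(add_lfunE, opp_lfunE); ring.
- case: (eps_al L A) => /(canRL (subrK _)) -> ->; rewrite !(tsD, tsN).
  by apply/lfunP => P; rewrite !(add_lfunE, opp_lfunE); ring.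
- by case: (xi_gam L A).
Qed.

(** The composite of the two shears and the shear of the sum differ by a map from l to the central
    ideal l^*, which [model_unique] ignores. *)
Lemma coactD z tau1 tau2 : Z2 z ->
  coact (coact z tau1) tau2 = coact z (tau1 + tau2).
Proof.
move=> zZ2; have [zc1 E1] := coactP tau1 zZ2.
have [zc2 E2] := coactP tau2 zc1; have [zc12 E12] := coactP (tau1 + tau2) zZ2.
apply: (@model_unique _ _ _ _ _ (d_sympLie zZ2) (shear tau1 \o shear tau2)%VF
  (shear (tau1 + tau2))) => //; first exact: bij_inj (shear_bij _).
- by move=> x y; rewrite !comp_lfunE E2 E1.
- move=> [[Z A] L] /= ->; rewrite comp_lfunE !shear0E tau_starPl opprD addrA.
  by rewrite [Z - _ - _]addrAC.
- move=> [[Z A] L]; rewrite comp_lfunE !shearE add_lfunE.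
  set u := (X in center X).
  suff -> : u = vec u.1.1 0 0 by move=> y; exact: d_br_center_dual.
  rewrite /u; congr (_, _, _) => /=; last by rewrite subrr.
  by rewrite [tau1 L + _]addrC [- (tau2 L + _)]opprD addrA subrr.
Qed.

Lemma coact0 z : Z2 z -> coact z 0 = z.
Proof.
move=> zZ2; have [zc0 E0] := coactP 0 zZ2.
have shear_id x : shear 0 x = x.
  case: x => [[Z A] L]; rewrite shearE zero_lfunE subr0 (lin0 (tau_star_lin 0)).
  suff -> : tau_star 0 A = 0 :> dual l by rewrite subr0 scaler0 addr0.
  by apply/lfunP => P; rewrite tau_starE !zero_lfunE linear0l.
by apply: d_br_inj => // x y; rewrite -[LHS]shear_id E0 !shear_id.
Qed.

Lemma H2_class_coact z tau : Z2 z -> H2_class (coact z tau) = H2_class z.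
Proof.
move=> zZ2; apply/seteqP; split=> _ [sig _ <-].
  by rewrite coactD //; exists (tau + sig).
by exists (sig - tau); rewrite // coactD // addrC subrK.
Qed.

Lemma H2_class_refl z : Z2 z -> H2_class z z.
Proof. by move=> zZ2; exists 0; rewrite ?coact0. Qed.

End CochainAction.

Section GroupAction.
Variables (R : realType) (l : vectType R) (a : sympLie R).
Local Notation vec Z A L := ((Z, A, L) : d_car l a).
Implicit Types (z : triple l a) (S : 'End(l)) (U : 'End(a)).

Lemma symp_iso_inv (g h : sympLie R) (phi : 'Hom(g, h)) :
  symp_iso phi -> symp_iso (phi^-1)%VF.
Proof.
move=> [/linear_bij[phiK phiVK] phi_br phi_om]; split.
- by exists phi.
- by move=> x y; apply: (can_inj phiK); rewrite phi_br !phiVK.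
- by move=> x y; rewrite -phi_om !phiVK.
Qed.

Lemma symp_iso_comp (g h k : sympLie R) (psi : 'Hom(h, k)) (phi : 'Hom(g, h)) :
  symp_iso psi -> symp_iso phi -> symp_iso (psi \o phi)%VF.
Proof.
move=> [psi_bij psi_br psi_om] [phi_bij phi_br phi_om]; split.
- by apply: (eq_bij (bij_comp psi_bij phi_bij)) => x; rewrite comp_lfunE.
- by move=> x y; rewrite !comp_lfunE phi_br psi_br.
- by move=> x y; rewrite !comp_lfunE psi_om phi_om.
Qed.

(** It maps the model of [gact S U z] to that of [z], hence the inverse of [U]; the contragredient
    of [S] on l^* keeps the pairing with l. *)
Definition rescale S U : 'Hom(d_car l a, d_car l a) :=
  linfun (fun x : d_car l a =>
    vec (x.1.1 \o S^-1)%VF ((U^-1)%VF x.1.2) (S x.2)).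

Lemma rescaleE S U Z A L :
  rescale S U (vec Z A L) = vec (Z \o S^-1)%VF ((U^-1)%VF A) (S L).
Proof.
rewrite /rescale linfun_linE // => k [[Z1 A1] L1] [[Z2 A2] L2] /=.
by congr (_, _, _); rewrite /= ?linearP // comp_lfunDl comp_lfunZl.
Qed.

Lemma rescale_omega S U x y : inG S U ->
  d_omega (rescale S U x) (rescale S U y) = d_omega x y.
Proof.
move=> [/linear_bij[SK _] /symp_iso_inv[_ _ U_om]].
case: x y => [[Z1 A1] L1] [[Z2 A2] L2].
by rewrite !rescaleE /= !comp_lfunE !SK U_om.
Qed.

Lemma d_isometry_inj (g : sympLie R) (psi : 'Hom(d_car l a, g)) :
  (forall x y, omega (psi x) (psi y) = d_omega x y) -> injective psi.
Proof.
move=> psi_om x y xy; apply: subr0_eq; apply: d_omega_nondeg => w.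
by rewrite -psi_om linearB /= xy subrr linear0l.
Qed.

Lemma gactP S U z : inG S U -> Z2 z -> Z2 (gact S U z) /\
  forall x y, rescale S U (d_br (gact S U z) x y) =
              d_br z (rescale S U x) (rescale S U y).
Proof.
move=> SU zZ2; have res_om x y := rescale_omega x y SU.
have res_bij : bijective (rescale S U).
  by apply: linear_inj_bij => //; exact: (@d_isometry_inj (d_sympLie zZ2)).
have [/linear_bij[SK SVK] [/linear_bij[UK UVK] U_br U_om]] := SU.
have UV_br A1 A2 : (U^-1)%VF (br A1 A2) = br ((U^-1)%VF A1) ((U^-1)%VF A2).
  by apply: (can_inj UK); rewrite U_br !UVK.
have [|Z|A1 A2|z' [z'Z2 z'E]] :=
  @standard_model R l a (d_sympLie zZ2) (rescale S U) res_bij.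
- exact: res_om.
- by move=> y; rewrite rescaleE !linear0; exact: d_br_center_dual.
- exists (beta z ((U^-1)%VF A1) ((U^-1)%VF A2) \o S)%VF.
  rewrite !rescaleE !linear0 -comp_lfunA comp_lfun0l.
  rewrite /br /= !(Z2_0E zZ2) !addr0 !subr0 UV_br.
  congr (_, _, _); apply/lfunP => L; by rewrite !comp_lfunE SVK.
have {}z'E x y : rescale S U (d_br z' x y) = d_br z (rescale S U x) (rescale S U y) :=
  z'E x y.
suff <- : z' = gact S U z by [].
have LA L A : vec (gam z' L A) (xi z' L A) 0 =
    vec (gam z (S L) ((U^-1)%VF A) \o S)%VF (U (xi z (S L) ((U^-1)%VF A))) 0.
  apply: (bij_inj res_bij); rewrite -(d_br_LA z'Z2) z'E !rescaleE !comp_lfun0l !linear0.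
  rewrite (d_br_LA zZ2) UK; congr (_, _, _).
  by apply/lfunP => P; rewrite !comp_lfunE SVK.
have LL L1 L2 : vec (eps z' L1 L2) (alpha z' L1 L2) 0 =
    vec (eps z (S L1) (S L2) \o S)%VF (U (alpha z (S L1) (S L2))) 0.
  apply: (bij_inj res_bij); rewrite -(d_br_LL z'Z2) z'E !rescaleE !comp_lfun0l !linear0.
  rewrite (d_br_LL zZ2) UK; congr (_, _, _).
  by apply/lfunP => P; rewrite !comp_lfunE SVK.
case: z' LA LL {z'Z2 z'E} => g e x /= LA LL; rewrite /gact.
congr Triple; apply/funext => L; apply/funext => A.
- by case: (LA L A).
- by case: (LL L A).
- by case: (LA L A).
Qed.

Lemma inG1 : inG (\1%VF : 'End(l)) (\1%VF : 'End(a)).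
Proof.
by split; [|split]; try (by exists id => x; rewrite id_lfunE);
  move=> x y; rewrite !id_lfunE.
Qed.

End GroupAction.

(** * Isomorphisms respecting the flag *)

Section FlagIsomorphisms.
Variables (R : realType) (l : vectType R) (a : sympLie R).
Local Notation vec Z A L := ((Z, A, L) : d_car l a).
Implicit Types z : triple l a.

Definition in_dual (l' : vectType R) (a' : sympLie R) (x : d_car l' a') : Prop :=
  x.1.2 = 0 /\ x.2 = 0.

(** The vectors without l-component form the orthogonal of l^*, and isometries carry orthogonals
    along. *)
Lemma in_dual_compl (l' : vectType R) (a' : sympLie R)
    (phi : 'Hom(d_car l a, d_car l' a')) :
    bijective phi -> (forall x y, d_omega (phi x) (phi y) = d_omega x y) ->
    (forall x, in_dual (phi x) <-> in_dual x) ->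
  forall x, (phi x).2 = 0 <-> x.2 = 0.
Proof.
move=> /linear_bij[phiK phiVK] phi_om phi_dual x.
have om_dual (l1 : vectType R) (a1 : sympLie R) (y y' : d_car l1 a1) :
    in_dual y' -> d_omega y y' = - y'.1.1 y.2.
  case: y y' => [[Z A] L] [[Z' A'] L'] [/= -> ->].
  by rewrite !linear0 !add0r.
split=> x0; apply: dual_separates => Z; apply/eqP; rewrite -oppr_eq0; apply/eqP.
  have dZ : in_dual (vec Z 0 0) by [].
  rewrite -(om_dual _ _ _ _ dZ) -phi_om om_dual; last exact/phi_dual.
  by rewrite x0 linear0 oppr0.
have dZ : in_dual ((Z, 0, 0) : d_car l' a') by [].
rewrite -(om_dual _ _ _ _ dZ) -[X in d_omega _ X]phiVK phi_om om_dual.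
  by rewrite x0 linear0 oppr0.
by apply/phi_dual; rewrite phiVK.
Qed.

(** [V] is the map induced on the quotient of l^* (+) a by l^*. The two models may have different
    middle terms, so that the lemma also serves to identify them. *)
Lemma flag_iso_middle (l' : vectType R) (a' : sympLie R) z1 (z2 : triple l' a')
    (phi : 'Hom(d_car l a, d_car l' a')) :
    Z2 z1 -> Z2 z2 -> bijective phi -> \dim {:a} = \dim {:a'} ->
    (forall x y, phi (d_br z1 x y) = d_br z2 (phi x) (phi y)) ->
    (forall x y, d_omega (phi x) (phi y) = d_omega x y) ->
    (forall x, in_dual (phi x) <-> in_dual x) ->
  exists2 V : 'Hom(a, a'), symp_iso V &
    forall Z A, exists Z', phi (vec Z A 0) = (Z', V A, 0).
Proof.
move=> zc1 zc2 phi_bij dim_a phi_br phi_om phi_dual.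
have phi2 := in_dual_compl phi_bij phi_om phi_dual.
pose V : 'Hom(a, a') := linfun (fun A => (phi (vec 0 A 0)).1.2).
have VE A : V A = (phi (vec 0 A 0)).1.2.
  rewrite /V linfun_linE // => k x y.
  have -> : vec 0 (k *: x + y) 0 = k *: vec 0 x 0 + vec 0 y 0.
    by congr (_, _, _); rewrite /= ?scaler0 ?addr0.
  by rewrite linearP.
have phiZA Z A : phi (vec Z A 0) = ((phi (vec Z A 0)).1.1, V A, 0).
  have : (phi (vec Z A 0)).2 = 0 by apply/phi2.
  have : (phi (vec Z A 0)).1.2 = V A.
    have -> : vec Z A 0 = vec Z 0 0 + vec 0 A 0.
      by congr (_, _, _); rewrite /= ?addr0 ?add0r.
    have [zc0 _] : in_dual (phi (vec Z 0 0)) by apply/phi_dual.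
    by rewrite linearD /= zc0 add0r -VE.
  by case: (phi _) => [[? ?] ?] /= -> ->.
have V_om A1 A2 : omega (V A1) (V A2) = omega A1 A2.
  have := phi_om (vec 0 A1 0) (vec 0 A2 0).
  by rewrite phiZA [phi (vec 0 A2 0)]phiZA /= !linear0 !addr0 !add0r.
have V_inj : injective V.
  by move=> x y xy; apply: omega_inj => w; rewrite -V_om xy V_om.
exists V; last by move=> Z A; exists (phi (vec Z A 0)).1.1.
split=> //; first exact: linear_inj_bij.
move=> A1 A2; have := phi_br (vec 0 A1 0) (vec 0 A2 0).
rewrite (d_br_AA zc1) phiZA [phi (vec 0 A1 0)]phiZA [phi (vec 0 A2 0)]phiZA.
by rewrite (d_br_AA zc2) => -[].
Qed.

Lemma flag_iso_orbit z1 z2 (phi : 'Hom(d_car l a, d_car l a)) :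
    Z2 z1 -> Z2 z2 -> bijective phi ->
    (forall x y, phi (d_br z1 x y) = d_br z2 (phi x) (phi y)) ->
    (forall x y, d_omega (phi x) (phi y) = d_omega x y) ->
    (forall x, in_dual (phi x) <-> in_dual x) ->
  exists S U tau, inG S U /\ z1 = coact (gact S U z2) tau.
Proof.
move=> zc1 zc2 phi_bij phi_br phi_om phi_dual.
have phi2 := in_dual_compl phi_bij phi_om phi_dual.
have vecL k L1 L2 : vec 0 0 (k *: L1 + L2) = k *: vec 0 0 L1 + vec 0 0 L2.
  by congr (_, _, _); rewrite /= ?scaler0 ?addr0.
pose S : 'End(l) := linfun (fun L => (phi (vec 0 0 L)).2).
pose t : 'Hom(l, a) := linfun (fun L => (phi (vec 0 0 L)).1.2).
have SE L : S L = (phi (vec 0 0 L)).2.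
  by rewrite /S linfun_linE // => k x y; rewrite vecL linearP.
have tE L : t L = (phi (vec 0 0 L)).1.2.
  by rewrite /t linfun_linE // => k x y; rewrite vecL linearP.
have [V V_iso V_phi] := flag_iso_middle zc1 zc2 phi_bij erefl phi_br phi_om phi_dual.
have phiZA Z A : phi (vec Z A 0) = vec (phi (vec Z A 0)).1.1 (V A) 0.
  by have [Z' ->] := V_phi Z A.
have phiL L : phi (vec 0 0 L) = vec (phi (vec 0 0 L)).1.1 (t L) (S L).
  by rewrite tE SE; case: (phi _) => [[]].
have S_bij : bijective S.
  apply: linear_inj_bij => // x y xy; apply: subr0_eq.
  by apply/(phi2 (vec 0 0 (x - y))); rewrite -SE linearB /= xy subrr.
have [/linear_bij[VK VVK] _ V_om] := V_iso.
have [/linear_bij[VIK VIVK] _ _] := symp_iso_inv V_iso.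
pose U : 'End(a) := (V^-1)%VF.
have UVE : (U^-1)%VF = V.
  by apply/lfunP => A; apply: (can_inj VVK); rewrite VIVK VK.
have SU : inG S U by split=> //; exact: symp_iso_inv.
(* Forced by the a-component on l: [rescale] after [shear] sends L to a vector with a-component - V
   (tau L), which must be t L. *)
pose tau : 'Hom(l, a) := - (U \o t)%VF.
have tauE L : tau L = - U (t L) by rewrite opp_lfunE comp_lfunE.
exists S, U, tau; split=> //.
have [zc3 E3] := gactP SU zc2; have [zc4 E4] := coactP tau zc3.
have [/linear_bij[SK SVK] _] := SU.
(* The a-components agree by the choice of [U]; the l^*-component is recovered by pairing with the
   images of l, using that [phi] is an isometry. *)
have eq0 Z A : phi (vec Z A 0) = rescale S U (shear tau (vec Z A 0)).
  rewrite phiZA shear0E rescaleE UVE linear0; congr (_, _, _).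
  apply/lfunP => L; rewrite -[L]SVK comp_lfunE SK add_lfunE opp_lfunE tau_starE tauE.
  have := phi_om (vec Z A 0) (vec 0 0 ((S^-1)%VF L)); rewrite phiZA phiL /=.
  rewrite !linear0 !addr0 => <-; rewrite linearNl /= opprK.
  by rewrite -[omega (U _) A]V_om VVK (omega_skew (t _)) addrK.
apply: (@model_unique _ _ _ _ _ (d_sympLie zc2) phi (rescale S U \o shear tau)%VF) => //.
- apply: (@d_isometry_inj _ _ _ (d_sympLie zc2)) => x y; rewrite !comp_lfunE.
  by rewrite [LHS](rescale_omega _ _ SU) shear_omega.
- by move=> x y; rewrite !comp_lfunE E4 E3.
- by move=> [[Z A] L] /= ->; rewrite comp_lfunE eq0.
- move=> [[Z A] L].
  suff -> : phi (vec Z A L) - (rescale S U \o shear tau)%VF (vec Z A L) =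
      vec (phi (vec 0 0 L) - rescale S U (shear tau (vec 0 0 L))).1.1 0 0.
    by move=> y; exact: d_br_center_dual.
  have -> : vec Z A L = vec Z A 0 + vec 0 0 L.
    by congr (_, _, _); rewrite /= ?addr0 ?add0r.
  rewrite linearD [(_ \o _)%VF (_ + _)]linearD /= !comp_lfunE eq0.
  rewrite opprD addrACA subrr add0r.
  rewrite phiL shearLE rescaleE UVE tauE opprK VVK.
  by congr (_, _, _); rewrite /= subrr.
Qed.

End FlagIsomorphisms.

(** * Isomorphism classes and the radical of the center *)

Section Isomorphisms.
Variable R : realType.
Implicit Types g h k : sympLie R.

Lemma isomorphic_refl g : isomorphic g g.
Proof.
exists \1%VF; split; try by move=> x y; rewrite !id_lfunE.
by exists id => x; rewrite id_lfunE.
Qed.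

Lemma isomorphic_sym g h : isomorphic g h -> isomorphic h g.
Proof. by case=> phi /symp_iso_inv; exists (phi^-1)%VF. Qed.

Lemma isomorphic_trans g h k : isomorphic g h -> isomorphic h k -> isomorphic g k.
Proof.
move=> [phi phi_iso] [psi psi_iso]; exists (psi \o phi)%VF.
exact: symp_iso_comp.
Qed.

Lemma iso_class_eqP g h : iso_class g = iso_class h <-> isomorphic g h.
Proof.
split=> [gh|gh]; last first.
  apply/funext => k; apply/propext; split=> [gk|hk].
    exact: isomorphic_trans (isomorphic_sym gh) gk.
  exact: isomorphic_trans gh hk.
have : iso_class h h by exact: isomorphic_refl.
by rewrite -gh.
Qed.

Definition rad_center g (x : g) : Prop :=
  center x /\ forall y, center y -> omega x y = 0.

Lemma center_iso g h (phi : 'Hom(g, h)) x :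
  symp_iso phi -> center (phi x) <-> center x.
Proof.
move=> [/linear_bij[phiK phiVK] phi_br _]; split=> cx y.
  by apply: (can_inj phiK); rewrite phi_br cx linear0.
by rewrite -[y]phiVK -phi_br cx linear0.
Qed.

Lemma rad_center_iso g h (phi : 'Hom(g, h)) x :
  symp_iso phi -> rad_center (phi x) <-> rad_center x.
Proof.
move=> phi_iso; have [/linear_bij[phiK phiVK] _ phi_om] := phi_iso.
split=> -[/(center_iso _ phi_iso) cx xy]; split=> // y cy.
  by rewrite -phi_om xy //; apply/center_iso.
by rewrite -[y]phiVK phi_om xy // -(center_iso _ phi_iso) phiVK.
Qed.

Lemma omega_br_center g (x y z : g) : center z -> omega (br x y) z = 0.
Proof.
move=> cz; have := omega_closed x y z.
by rewrite (br_skew y) !cz oppr0 !linear0l !addr0.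
Qed.

End Isomorphisms.

(** * Sharpness in terms of the center *)

Section Sharp.
Variables (R : realType) (l : vectType R) (a : sympLie R).
Local Notation vec Z A L := ((Z, A, L) : d_car l a).

Lemma d_omega_dual Z Z' A' L' : d_omega (vec Z 0 0) (vec Z' A' L') = Z L'.
Proof. by rewrite /= linear0 linear0l subr0 addr0. Qed.

Lemma d_omega_middle Z A Z' A' : d_omega (vec Z A 0) (vec Z' A' 0) = omega A A'.
Proof. by rewrite /= !linear0 add0r addr0. Qed.

Variables (z : triple l a) (zZ2 : Z2 z).

Lemma d_centerP Z A L : center (vec Z A L : d_sympLie zZ2) <->
  [/\ forall B, br A B + xi z L B = 0, forall B, gam z L B + beta z A B = 0,
      forall L', alpha z L L' = xi z L' A & forall L', eps z L L' = gam z L' A].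
Proof.
rewrite -(d_br_eq0P zZ2).
have brE y : br (vec Z A L : d_sympLie zZ2) y = d_br z (vec 0 A L) y.
  by case: y => [[]].
by split=> H y; have := H y; rewrite brE.
Qed.

Lemma central_partP A : central_part z A <-> center (vec 0 A 0 : d_sympLie zZ2).
Proof.
rewrite d_centerP; split=> -[H1 H2 H3 H4]; split=> B.
- by rewrite (Z2_0E zZ2) addr0; exact: H1.
- by rewrite (Z2_0E zZ2) add0r H2.
- by rewrite (Z2_0E zZ2) H3.
- by rewrite (Z2_0E zZ2) H4.
- by have := H1 B; rewrite (Z2_0E zZ2) addr0.
- by have := H2 B; rewrite (Z2_0E zZ2) add0r.
- by rewrite -H3 (Z2_0E zZ2).
- by rewrite -H4 (Z2_0E zZ2).
Qed.

(* Condition (a) says that the center lies in l^* (+) a, and condition (b) that *)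
(* it is the direct sum of l^* and a nondegenerate subspace of a.               *)
Lemma Z2_sharpP : Z2_sharp z <->
  forall x : d_sympLie zZ2, rad_center x <-> in_dual x.
Proof.
have dual_center Z : center (vec Z 0 0 : d_sympLie zZ2).
  by move=> y; exact: d_br_center_dual.
split=> [[_ Ha Hb] [[Z A] L]|Hrad].
  have center0 Z' A' L' : center (vec Z' A' L' : d_sympLie zZ2) -> L' = 0.
    by move=> /d_centerP ?; apply: Ha; exists A'.
  split=> [[cx ox]|[/= -> ->]]; last first.
    by split=> // -[[Z' A'] L'] /center0 ->; rewrite [LHS]d_omega_dual linear0.
  have L0 := center0 _ _ _ cx; rewrite L0 in cx ox *; split=> //=.
  have cA B Z' : center (vec Z' B 0 : d_sympLie zZ2) -> central_part z B.
    by move=> /d_centerP cB; apply/central_partP/d_centerP.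
  apply: Hb => [|B /central_partP/ox <-]; first exact: cA cx.
  by rewrite [RHS]d_omega_middle.
have center0 Z A L : center (vec Z A L : d_sympLie zZ2) -> L = 0.
  move=> cx; apply: dual_separates => Z'.
  have [_ /(_ _ cx) <-] : rad_center (vec Z' 0 0 : d_sympLie zZ2) by apply/Hrad.
  by rewrite [RHS]d_omega_dual.
split=> //.
  by move=> L [A /(d_centerP 0)]; exact: center0.
move=> A /central_partP cA AB.
suff [] : in_dual (vec 0 A 0) by [].
apply/Hrad; split=> // -[[Z' B] L'] cy; have L0 := center0 _ _ _ cy.
rewrite L0 [LHS]d_omega_middle; apply: AB.
by apply/central_partP/d_centerP; move/d_centerP: cy; rewrite L0.
Qed.

End Sharp.

(** * Orbits and isomorphisms preserving the flag *)

Section Orbits.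
Variable R : realType.

Lemma d_iso_in_dual (l l' : vectType R) (a a' : sympLie R) (z : triple l a)
    (z' : triple l' a') (zZ2 : Z2 z) (z'Z2 : Z2 z')
    (phi : 'Hom(d_sympLie zZ2, d_sympLie z'Z2)) :
  Z2_sharp z -> Z2_sharp z' -> symp_iso phi ->
  forall x, in_dual (phi x : d_car l' a') <-> in_dual (x : d_car l a).
Proof.
move=> /(Z2_sharpP zZ2) sz /(Z2_sharpP z'Z2) sz' phi_iso x.
by rewrite -sz' -sz; exact: rad_center_iso.
Qed.

Lemma d_iso_dim (l l' : vectType R) (a a' : sympLie R) (z : triple l a)
    (z' : triple l' a') (zZ2 : Z2 z) (z'Z2 : Z2 z') :
  Z2_sharp z -> Z2_sharp z' -> isomorphic (d_sympLie zZ2) (d_sympLie z'Z2) ->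
  (\dim {:l} <= \dim {:l'})%N.
Proof.
move=> sz sz' [phi phi_iso]; have phi_dual := d_iso_in_dual sz sz' phi_iso.
have [/bij_inj phi_inj _ _] := phi_iso.
rewrite -dim_dual -(dim_dual l').
pose f (Z : dual l) : dual l' := (phi ((Z, 0, 0) : d_car l a) : d_car l' a').1.1.
have lf : linear f.
  move=> k Z1 Z2; rewrite /f.
  have -> : (k *: Z1 + Z2, 0, 0) = k *: (Z1, 0, 0) + (Z2, 0, 0) :> d_car l a.
    by congr (_, _, _); rewrite /= ?scaler0 ?addr0.
  by rewrite linearP.
apply: (@linear_inj_dim _ _ _ (linfun f)) => Z1 Z2; rewrite !linfun_linE // => fZ.
have phiE Z : phi ((Z, 0, 0) : d_car l a) = (f Z, 0, 0) :> d_car l' a'.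
  have [] : in_dual (phi ((Z, 0, 0) : d_car l a) : d_car l' a') by apply/phi_dual.
  by rewrite /f; case: (phi _) => [[? ?] ?] /= -> ->.
suff [] : (Z1, 0, 0) = (Z2, 0, 0) :> d_car l a by [].
by apply: phi_inj; rewrite !phiE fZ.
Qed.

Variables (l : vectType R) (a : sympLie R).
Implicit Types z : triple l a.

(** Preservation of l^* is demanded here rather than deduced from sharpness, so the relation can be
    chained through [coact] and [gact] without knowing that the intermediate cocycles are sharp. *)
Definition flag_iso z1 z2 : Prop :=
  exists phi : 'Hom(d_car l a, d_car l a),
    [/\ bijective phi, forall x y, phi (d_br z1 x y) = d_br z2 (phi x) (phi y),
        forall x y, d_omega (phi x) (phi y) = d_omega x y &
        forall x, in_dual (phi x) <-> in_dual x].

Lemma flag_iso_sym z1 z2 : flag_iso z1 z2 -> flag_iso z2 z1.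
Proof.
move=> [phi [/linear_bij[phiK phiVK] phi_br phi_om phi_dual]].
exists (phi^-1)%VF; split.
- by exists phi.
- by move=> x y; apply: (can_inj phiK); rewrite phi_br !phiVK.
- by move=> x y; rewrite -phi_om !phiVK.
- by move=> x; rewrite -phi_dual phiVK.
Qed.

Lemma flag_iso_trans z1 z2 z3 : flag_iso z1 z2 -> flag_iso z2 z3 -> flag_iso z1 z3.
Proof.
move=> [phi [phi_bij phi_br phi_om phi_dual]] [psi [psi_bij psi_br psi_om psi_dual]].
exists (psi \o phi)%VF; split.
- by apply: (eq_bij (bij_comp psi_bij phi_bij)) => x; rewrite comp_lfunE.
- by move=> x y; rewrite !comp_lfunE phi_br psi_br.
- by move=> x y; rewrite !comp_lfunE psi_om phi_om.
- by move=> x; rewrite comp_lfunE psi_dual.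
Qed.

Lemma flag_iso_coact z tau : Z2 z -> flag_iso (coact z tau) z.
Proof.
move=> zZ2; exists (shear tau); split.
- exact: shear_bij.
- exact: (coactP tau zZ2).2.
- exact: shear_omega.
- move=> [[Z A] L]; rewrite shearE /in_dual /=.
  by split=> -[+ L0]; rewrite L0 linear0 subr0 => ->.
Qed.

Lemma flag_iso_gact z S U : Z2 z -> inG S U -> flag_iso (gact S U z) z.
Proof.
move=> zZ2 SU; have [/linear_bij[SK _] /symp_iso_inv[/bij_inj U_inj _ _]] := SU.
have res_om x y := rescale_omega x y SU.
exists (rescale S U); split=> //.
- by apply: linear_inj_bij => //; exact: (@d_isometry_inj _ _ _ (d_sympLie zZ2)).
- exact: (gactP SU zZ2).2.
- move=> [[Z A] L]; rewrite rescaleE /in_dual /=; split=> -[A0 L0].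
    by split; [apply: U_inj | apply: (can_inj SK)]; rewrite ?A0 ?L0 linear0.
  by rewrite A0 L0 !linear0.
Qed.

Lemma flag_iso_isomorphic z1 z2 (zc1 : Z2 z1) (zc2 : Z2 z2) :
  flag_iso z1 z2 -> isomorphic (d_sympLie zc1) (d_sympLie zc2).
Proof. by move=> [phi [? ? ? _]]; exists phi. Qed.

Lemma isomorphic_flag_iso z1 z2 (zc1 : Z2 z1) (zc2 : Z2 z2) :
  Z2_sharp z1 -> Z2_sharp z2 ->
  isomorphic (d_sympLie zc1) (d_sympLie zc2) -> flag_iso z1 z2.
Proof.
move=> s1 s2 [phi phi_iso]; have [phi_bij phi_br phi_om] := phi_iso.
by exists phi; split=> //; exact: d_iso_in_dual s1 s2 phi_iso.
Qed.

(** Members of an orbit are reached by shears and rescalings, which are flag isomorphisms;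
    conversely [flag_iso_orbit] writes each flag isomorphism as these two moves. *)
Lemma G_orbit_eqP z1 z2 : Z2 z1 -> Z2 z2 ->
  G_orbit (H2_class z1) = G_orbit (H2_class z2) <-> flag_iso z1 z2.
Proof.
have sub w1 w2 : Z2 w1 -> Z2 w2 -> flag_iso w1 w2 ->
    G_orbit (H2_class w1) `<=` G_orbit (H2_class w2).
  move=> zc1 zc2 w12 _ [S [U [_ [SU [tau _ <-] ->]]]].
  have [zc3 _] := coactP tau zc1; have [zc4 _] := gactP SU zc3.
  have [phi [phi_bij phi_br phi_om phi_dual]] : flag_iso (gact S U (coact w1 tau)) w2.
    apply: flag_iso_trans (flag_iso_gact zc3 SU) _.
    exact: flag_iso_trans (flag_iso_coact tau zc1) w12.
  have [S' [U' [tau' [SU' ->]]]] :=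
    flag_iso_orbit zc4 zc2 phi_bij phi_br phi_om phi_dual.
  exists S', U', w2; split=> //; first exact: H2_class_refl.
  by rewrite H2_class_coact //; exact: (gactP SU' zc2).1.
move=> zc1 zc2; split=> [eq12|w12]; last first.
  by apply/seteqP; split; apply: sub => //; exact: flag_iso_sym.
(* The identity pair puts the class of [gact \1 \1 z1] into the orbit; that this triple is [z1]
   itself need not be shown, since a flag isomorphism links the two. *)
have SU1 := inG1 l a; have [zc3 _] := gactP SU1 zc1.
have : G_orbit (H2_class z1) (H2_class (gact \1%VF \1%VF z1)).
  by exists \1%VF, \1%VF, z1; split=> //; exact: H2_class_refl.
rewrite eq12 => -[S [U [_ [SU [tau _ <-] class_eq]]]].
have [zc4 _] := coactP tau zc2; have [zc5 _] := gactP SU zc4.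
have := H2_class_refl zc3; rewrite class_eq => -[tau' _ z1E].
apply: flag_iso_trans (flag_iso_sym (flag_iso_gact zc1 SU1)) _.
rewrite -z1E; apply: flag_iso_trans (flag_iso_coact tau' zc5) _.
exact: flag_iso_trans (flag_iso_gact zc4 SU) (flag_iso_coact tau zc2).
Qed.

End Orbits.

Lemma d_iso_middle (R : realType) (l l' : vectType R) (a a' : sympLie R)
    (z : triple l a) (z' : triple l' a') (zZ2 : Z2 z) (z'Z2 : Z2 z') :
  Z2_sharp z -> Z2_sharp z' -> \dim {:a} = \dim {:a'} ->
  isomorphic (d_sympLie zZ2) (d_sympLie z'Z2) -> isomorphic a a'.
Proof.
move=> sz sz' dim_a [phi phi_iso]; have [phi_bij phi_br phi_om] := phi_iso.
have [V V_iso _] := @flag_iso_middle _ _ _ _ _ _ _ phi zZ2 z'Z2 phi_bij dim_a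
  phi_br phi_om (d_iso_in_dual sz sz' phi_iso).
by exists V.
Qed.

(** * Nilpotency of the extension *)

Section Nilpotency.
Variable R : realType.

Lemma upper_central_iso (g h : sympLie R) (phi : 'Hom(g, h)) k x :
  symp_iso phi -> upper_central k x -> upper_central k (phi x).
Proof.
move=> [/linear_bij[phiK phiVK] phi_br _].
elim: k x => [|k IHk] x /=; first by move=> ->; rewrite linear0.
by move=> xk y; rewrite -[y]phiVK -phi_br; exact: IHk.
Qed.

Lemma nilpotent_iso (g h : sympLie R) : isomorphic g h -> nilpotent g -> nilpotent h.
Proof.
move=> [phi phi_iso] /nilpotentP[k gk]; apply/nilpotentP; exists k => v.
have [/linear_bij[_ phiVK] _ _] := phi_iso.
by rewrite -[v]phiVK; exact: upper_central_iso.
Qed.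

Variables (l : vectType R) (a : sympLie R) (z : triple l a) (zZ2 : Z2 z).
Local Notation vec Z A L := ((Z, A, L) : d_sympLie zZ2).

Lemma d_upper_central k Z A : upper_central k (vec Z A 0) ->
  upper_central k A /\ forall s : seq l, size s = k -> foldr (xi z) A s = 0.
Proof.
elim: k Z A => [|k IHk] Z A; first by case=> _ ->; split=> // -[].
move=> Ak; split=> [B|s].
  have := Ak (vec 0 B 0); rewrite /br /= !(Z2_0E zZ2) !subr0 !addr0.
  by move=> /IHk[].
(* [foldr] lets the last letter act first, so this letter is the one supplied by the first bracket
   with A. *)
case: (lastP s) => [//|{}s L]; rewrite size_rcons foldr_rcons => -[sk].
have := Ak (vec 0 0 L); rewrite /br /= !(Z2_0E zZ2) linear0l !subr0 !addr0 !add0r.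
by move=> /IHk[_]; exact.
Qed.

Lemma xi_upper_central k L A : upper_central k A -> upper_central k (xi z L A).
Proof.
elim: k A => [|k IHk] A /=; first by move=> ->; rewrite (Z2_0E zZ2).
move=> Ak B.
have -> : br B (xi z L A) = xi z L (br B A) - br (xi z L B) A.
  by rewrite (Z2_xi_der zZ2) addrAC subrr add0r.
by apply: upper_centralD; [exact: IHk | apply: upper_centralN; exact: Ak].
Qed.

(** Iterated brackets project to iterated brackets of [a] and to words in xi. Conversely, the upper
    central series of [a] is climbed: each stage costs at most N further brackets, during which the
    words in xi run out while brackets inside [a] fall to the previous stage. *)
Lemma d_nilpotentP : nilpotent (d_sympLie zZ2) <->
  nilpotent a /\ exists N, forall (s : seq l) A, size s = N -> foldr (xi z) A s = 0.
Proof.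
split=> [/nilpotentP[k dk]|[/nilpotentP[c ac] [N xiN]]].
  split; first by apply/nilpotentP; exists k => A;
    case: (d_upper_central (dk (vec 0 A 0))).
  by exists k => s A sk; case: (d_upper_central (dk (vec 0 A 0))) => _; exact.
have [M dM] : exists M, forall A Z, upper_central c A -> upper_central M (vec Z A 0).
  elim: c {ac} => [|c [M dM]].
    by exists 1%N => _ Z -> y; rewrite br_skew [br _ _](d_br_center_dual zZ2) oppr0.
  exists (N + M)%N.
  (* Modulo the [c]-th upper central subspace only the summand [xi] of each *)
  (* bracket acts, so that [A] may be replaced by a representative [B] on   *)
  (* which words of length [k] in [xi] vanish.                              *)
  suff H k A B Z : (forall s : seq l, size s = k -> foldr (xi z) B s = 0) ->
      upper_central c.+1 B -> upper_central c (A - B) ->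
      upper_central (k + M) (vec Z A 0).
    move=> A Z Ac; apply: (H N A A) => //; first by move=> s; exact: xiN.
    by rewrite subrr; exact: upper_central0.
  elim: k A B Z => [|k IHk] A B Z xiB Bc ABc.
    by apply: dM; have := xiB [::] erefl => /= B0; rewrite B0 subr0 in ABc.
  move=> [[Z' A'] L].
  have Ac : upper_central c.+1 A.
    by rewrite -[A](subrK B); apply: upper_centralD => //; exact: upper_centralS.
  rewrite /br /= !(Z2_0E zZ2) subr0 addr0.
  apply: (IHk _ (xi z L B)).
  - by move=> s sk; rewrite -foldr_rcons xiB // size_rcons sk.
  - exact: xi_upper_central.
  - rewrite subr0 addr0 -addrA; apply: upper_centralD; first exact: (Ac A').
    rewrite -(linN ((Z2_xi_bilin zZ2).2 L)) -(linD ((Z2_xi_bilin zZ2).2 L)).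
    exact: xi_upper_central.
(* One extra bracket is spent on entering l^* (+) a. *)
apply/nilpotentP; exists M.+1 => x y.
suff [Z' [A' ->]] : exists Z' A', br y x = vec Z' A' 0 by exact: dM.
by case: x y => [[Z1 A1] L1] [[Z2 A2] L2]; do 2 eexists.
Qed.

End Nilpotency.

(** * Reduction along the radical of the center *)

Lemma inj_surj_bij (T U : Type) (f : T -> U) :
  injective f -> (forall y, exists x, f x = y) -> bijective f.
Proof.
move=> f_inj /choice[g gK]; exists g => // x.
by apply: f_inj; rewrite gK.
Qed.

Section Reduction.
Variables (R : realType) (g : sympLie R).

(** Here [i] identifies the dual of R^m with [j], [p] has kernel the orthogonal of [j], and [q'] is
    a section of [p] with isotropic image; [W] is what is orthogonal to both [j] and that image. *)
Lemma isotropic_splitting (j : {vspace g}) :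
    (forall x y, x \in j -> y \in j -> omega x y = 0) ->
  exists (W : {vspace g})
    (psi : 'Hom((dual 'rV[R]_(\dim j) * subvs_of W * 'rV[R]_(\dim j))%type, g)),
  [/\ bijective psi,
      forall Z A L Z' A' L', omega (psi (Z, A, L)) (psi (Z', A', L')) =
        Z L' + omega (vsval A) (vsval A') - Z' L &
      forall x, x \in j <-> exists Z, x = psi (Z, 0, 0)].
Proof.
set m := \dim j => j_iso; pose b : m.-tuple g := vbasis j.
have b_j k : b`_k \in j.
  have [km|mk] := ltnP k m; first by rewrite vbasis_mem // mem_nth ?size_tuple.
  by rewrite nth_default ?mem0v // size_tuple.
have om_suml n (f : 'I_n -> g) x : omega (\sum_k f k) x = \sum_k omega (f k) x.
  rewrite omega_skew linear_sumr -sumrN; apply: eq_bigr => k _ /=.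
  by rewrite [RHS]omega_skew.
pose i : 'Hom(dual 'rV[R]_m, g) :=
  linfun (fun Z : dual 'rV[R]_m => \sum_(k < m) (Z (delta_mx 0 k) : R) *: b`_k).
have iE Z : i Z = \sum_(k < m) (Z (delta_mx 0 k) : R) *: b`_k.
  rewrite /i linfun_linE // => c Z1 Z2; rewrite scaler_sumr -big_split /=.
  by apply: eq_bigr => k _; rewrite add_lfunE scale_lfunE scalerDl scalerA.
pose p : 'Hom(g, 'rV[R]_m) := linfun (fun x => \row_k omega b`_k x).
have pE x k : p x 0 k = omega b`_k x.
  by rewrite /p linfun_linE ?mxE // => c x1 x2; apply/rowP => n; rewrite !mxE linearPr.
have om_i Z x : omega (i Z) x = Z (p x).
  rewrite iE om_suml [p x]row_sum_delta linear_sum.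
  by apply: eq_bigr => k _; rewrite linearZ linearZl /= pE mulrC.
(* The vectors d_k represent the coordinates of the basis of [j], so pairing b_n with d_k gives
   minus the Kronecker delta. This is the source of the sign in [q]. *)
have dP k : exists v, forall x, omega v x = coord b k x.
  have lin : linear (coord b k : g -> R^o) by move=> c x y; rewrite linearP.
  have [v vE] := omega_surj (linfun (coord b k : g -> R^o)).
  by exists v => x; rewrite vE linfun_linE.
have [d dE] := choice dP.
pose q : 'Hom('rV[R]_m, g) := linfun (fun L : 'rV[R]_m => - \sum_k L 0 k *: d k).
have qE L : q L = - \sum_k L 0 k *: d k.
  rewrite /q linfun_linE // => c L1 L2; rewrite scalerN scaler_sumr -opprD -big_split /=.
  by congr (- _); apply: eq_bigr => k _; rewrite !mxE scalerDl scalerA.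
have j_perp x : x \in j -> p x = 0.
  by move=> xj; apply/rowP => k; rewrite pE mxE j_iso.
have pq L : p (q L) = L.
  apply/rowP => k; rewrite pE qE omega_skew linearNl opprK om_suml.
  rewrite (bigD1 k) //= big1 ?addr0 => [|n nk]; rewrite linearZl /= dE.
    by rewrite coord_free ?(basis_free (vbasisP j)) // eqxx mulr1.
  by rewrite coord_free ?(basis_free (vbasisP j)) // eq_sym (negbTE nk) mulr0.
(* Shifting [q] by vectors of [j] alters the form on its image by K L L' - K L' L; minus half of the
   form itself makes the result vanish. *)
pose K L : dual 'rV[R]_m := linfun (fun L' => - (2^-1 * omega (q L) (q L')) : R^o).
have KE L L' : K L L' = - (2^-1 * omega (q L) (q L')).
  rewrite /K linfun_linE // => c x y; rewrite !linearP /= scaleoE; ring.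
pose q' : 'Hom('rV[R]_m, g) := linfun (fun L => q L + i (K L)).
have q'E L : q' L = q L + i (K L).
  rewrite /q' linfun_linE // => c x y.
  have -> : K (c *: x + y) = c *: K x + K y.
    apply/lfunP => L'; rewrite add_lfunE scale_lfunE !KE linearP linearPl /=.
    rewrite scaleoE; ring.
  by rewrite !linearP scalerDr addrACA.
have i_j Z : i Z \in j.
  by rewrite iE memv_suml // => k _; rewrite memvZ.
have p_i Z : p (i Z) = 0 by exact/j_perp/i_j.
have pq' L : p (q' L) = L by rewrite q'E linearD /= pq p_i addr0.
have q'_iso L L' : omega (q' L) (q' L') = 0.
  rewrite !q'E !linearDl /= !linearDr /= [omega (q L) (i _)]omega_skew !om_i.
  rewrite !pq p_i linear0 !KE (omega_skew (q L')); lra.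
have [W WP] : exists W : {vspace g}, forall x,
    x \in W <-> p x = 0 /\ forall L, omega (q' L) x = 0.
  apply: submod_vspace; first by split=> [|L]; rewrite ?linear0 ?linear0r.
  move=> c x y [px qx] [py qy]; split=> [|L].
    by rewrite linearP /= px py scaler0 addr0.
  by rewrite linearPr /= qx qy mulr0 addr0.
pose f (x : (dual 'rV[R]_m * subvs_of W * 'rV[R]_m)%type) :=
  i x.1.1 + vsval x.1.2 + q' x.2.
pose psi := linfun f.
have psiE Z A L : psi (Z, A, L) = i Z + vsval A + q' L.
  rewrite /psi linfun_linE // => c [[Z1 A1] L1] [[Z2 A2] L2]; rewrite /f /= !linearP /=.
  by rewrite !scalerDr [X in X + _ = _]addrACA [LHS]addrACA.
have W_om (A : subvs_of W) : p (vsval A) = 0 /\ forall L, omega (q' L) (vsval A) = 0.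
  by apply/WP; exact: subvsP.
have psi_om Z A L Z' A' L' : omega (psi (Z, A, L)) (psi (Z', A', L')) =
        Z L' + omega (vsval A) (vsval A') - Z' L.
  have [pA qA] := W_om A; have [pA' qA'] := W_om A'.
  rewrite !psiE !linearDl /= !linearDr /= !om_i q'_iso qA' p_i pA' pq'.
  rewrite [omega (vsval A) (i _)]omega_skew [omega (vsval A) (q' _)]omega_skew qA.
  rewrite [omega (q' _) (i _)]omega_skew !om_i pA pq' !linear0 !addr0 !add0r.
  by rewrite oppr0 add0r addr0.
exists W, psi; split=> //; last first.
  move=> x; split=> [xj|[Z ->]]; last by rewrite psiE !linear0 !addr0.
  exists (linfun (fun L : 'rV[R]_m => \sum_(k < m) L 0 k *: (coord b k x : R^o))).
  rewrite psiE !linear0 !addr0 iE {1}(coord_vbasis xj); apply: eq_bigr => k _.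
  congr (_ *: _); rewrite linfun_linE => [|c L1 L2]; last first.
    rewrite scaler_sumr -big_split /=; apply: eq_bigr => n _.
    by rewrite !mxE scalerDl scalerA.
  rewrite (bigD1 k) //= big1 ?addr0 => [|n nk]; rewrite mxE eqxx.
    by rewrite eqxx scale1r.
  by rewrite (negbTE nk) scale0r.
apply: inj_surj_bij.
  move=> x y xy; apply: subr0_eq.
  have : psi (x - y) = 0 by rewrite linearB /= xy subrr.
  case: (x - y) => [[Z A] L] psi0.
  have Z0 : Z = 0.
    apply/lfunP => L'; have := psi_om Z A L 0 0 L'.
    by rewrite psi0 linear0l zero_lfunE !linear0 !addr0 => <-; rewrite zero_lfunE.
  have L0 : L = 0.
    apply: dual_separates => Z'; have := psi_om Z A L Z' 0 0.
    rewrite psi0 linear0l !linear0 !add0r => /esym/eqP.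
    by rewrite oppr_eq0 => /eqP.
  move: psi0; rewrite psiE Z0 L0 !linear0 add0r addr0 => A0.
  by congr (_, _, _); apply: subvs_inj; rewrite A0 linear0.
move=> x.
pose x' := x - q' (p x).
(* [x'] is already orthogonal to [j]; its part in [j] is forced by requiring the remainder to be
   orthogonal to the image of [q']. *)
pose Z : dual 'rV[R]_m := linfun (fun L => - omega (q' L) x' : R^o).
have ZE L : Z L = - omega (q' L) x'.
  by rewrite /Z linfun_linE // => c L1 L2; rewrite linearP linearPl /= scaleoE; ring.
have x'W : x' - i Z \in W.
  apply/WP; split=> [|L].
    by rewrite !linearB /= p_i pq' subr0 subrr.
  rewrite linearB /= [omega (q' L) (i Z)]omega_skew om_i pq' ZE; ring.
exists (Z, vsproj W (x' - i Z), p x).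
by rewrite psiE vsprojK // addrC [i Z + _]addrC !subrK addrC subrK.
Qed.

(** [W] plays the role of the quotient of the orthogonal of [j] by [j], with the middle component of
    the bracket of [g] as its bracket. The component dropped lies in [j], hence is central and
    orthogonal to [W], so the Jacobi identity and closedness survive. *)
Lemma symplectic_reduction (j : {vspace g}) (W : {vspace g})
    (psi : 'Hom((dual 'rV[R]_(\dim j) * subvs_of W * 'rV[R]_(\dim j))%type, g)) :
    (forall x, x \in j -> center x) -> bijective psi ->
    (forall Z A L Z' A' L', omega (psi (Z, A, L)) (psi (Z', A', L')) =
        Z L' + omega (vsval A) (vsval A') - Z' L) ->
    (forall x, x \in j <-> exists Z, x = psi (Z, 0, 0)) ->
  exists a : sympLie R, exists2 phi : 'Hom(d_car 'rV[R]_(\dim j) a, g),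
    bijective phi &
    [/\ forall x y, omega (phi x) (phi y) = d_omega x y,
        forall x, x \in j <-> exists Z, x = phi (Z, 0, 0) &
        forall A1 A2, exists Z,
          br (phi (0, A1, 0)) (phi (0, A2, 0)) = phi (Z, br A1 A2, 0)].
Proof.
move=> j_cent psi_bij psi_om psi_j.
have [psiK psiVK] := linear_bij psi_bij.
pose V : vectType R := subvs_of W.
have psi_cent Z : center (psi (Z, 0, 0)) by apply: j_cent; apply/psi_j; exists Z.
pose e : 'Hom(V, g) := linfun (fun A => psi (0, A, 0)).
have eE A : e A = psi (0, A, 0).
  rewrite /e linfun_linE // => c A1 A2.
  have -> : (0, c *: A1 + A2, 0) = c *: (0, A1, 0) + (0, A2, 0)
    :> (dual 'rV[R]_(\dim j) * subvs_of W * 'rV[R]_(\dim j))%type.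
    by congr (_, _, _); rewrite /= ?scaler0 ?addr0.
  by rewrite linearP.
have e_om A B : omega (e A) (e B) = omega (vsval A) (vsval B).
  by rewrite !eE psi_om !linear0 add0r addr0.
pose b (A B : V) : V := ((psi^-1)%VF (br (e A) (e B))).1.2.
have b_bilin : bilinear_for *:%R *:%R b.
  by split=> A c B1 B2; rewrite /b /= linearP ?linearPl ?linearPr /= linearP.
have brE A B : exists Z, br (e A) (e B) = psi (Z, 0, 0) + e (b A B).
  have psi2 x y : ((psi^-1)%VF (br x y)).2 = 0.
    apply: dual_separates => Z; have := omega_br_center x y (psi_cent Z).
    rewrite -{1}[br x y]psiVK; case: (psi^-1%VF _) => [[Z' A'] L'].
    rewrite psi_om !linear0 !add0r /= => /eqP.
    by rewrite oppr_eq0 => /eqP.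
  exists ((psi^-1)%VF (br (e A) (e B))).1.1; rewrite [e (b A B)]eE -(linearD psi).
  rewrite -[LHS]psiVK.
  congr (psi _); rewrite /b; move: (psi2 (e A) (e B)).
  by case: (psi^-1%VF _) => [[Z' A'] L'] /= ->; congr (_, _, _); rewrite /= ?add0r ?addr0.
have br_e A B C : exists Z, br (e A) (br (e B) (e C)) = psi (Z, 0, 0) + e (b A (b B C)).
  have [Z ->] := brE B C; have [Z' E] := brE A (b B C); exists Z'.
  by rewrite linearDr /= br_skew psi_cent oppr0 add0r.
have e_inj : injective e.
  by move=> A B; rewrite !eE => /(can_inj psiK)[].
have om_psi Z A B : omega (psi (Z, 0, 0) + e A) (e B) = omega (e A) (e B).
  by rewrite linearDl /= [X in X + _]omega_skew eE psi_om !linear0 !add0r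
    !oppr0 ?addr0 add0r.
pose bB : {bilinear V -> V -> V} :=
  HB.pack b (bilinear_isBilinear.Build R _ _ _ _ _ b b_bilin).
pose om (A B : V) : R := omega (vsval A) (vsval B).
have om_bilin : bilinear_for *%R *%R om.
  by split=> A c B1 B2; rewrite /om /= ?linearPl ?linearPr.
pose omB : {biscalar V} :=
  HB.pack om (bilinear_isBilinear.Build R _ _ _ _ _ om om_bilin).
have b_alt A : bB A A = 0.
  by rewrite /= /b br_alt linear0.
have b_jac A B C : bB A (bB B C) + bB B (bB C A) + bB C (bB A B) = 0.
  have [Z1 E1] := br_e A B C; have [Z2 E2] := br_e B C A; have [Z3 E3] := br_e C A B.
  have := br_jacobi (e A) (e B) (e C); rewrite E1 E2 E3 !eE -!(linearD psi).
  rewrite -(linear0 psi) => /(can_inj psiK)/(congr1 (fun x => x.1.2)).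
  by rewrite /= !add0r.
have om_skew A B : omB A B = - omB B A by exact: omega_skew.
have om_nondeg A : (forall B, omB A B = 0) -> A = 0.
  move=> A0; apply: e_inj; rewrite linear0; apply: omega_nondeg => y.
  rewrite -[y]psiVK; case: (psi^-1%VF _) => [[Z B] L].
  by rewrite eE psi_om zero_lfunE linear0 subr0 add0r; exact: A0.
have om_closed A B C : omB (bB A B) C + omB (bB B C) A + omB (bB C A) B = 0.
  have omE X Y Z : omB (bB X Y) Z = omega (br (e X) (e Y)) (e Z).
    by have [T ->] := brE X Y; rewrite om_psi e_om.
  by rewrite !omE omega_closed.
pose a : sympLie R :=
  @SympLie R (@LieAlg R V bB b_alt b_jac) omB om_skew om_nondeg om_closed.
exists a, psi => //; split=> [[[Z A] L] [[Z' A'] L']| |A1 A2].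
- exact: psi_om.
- exact: psi_j.
- have [Z E] := brE A1 A2; exists Z; rewrite -!eE E eE -(linearD psi).
  by congr (psi _); congr (_, _, _); rewrite /= ?addr0 ?add0r.
Qed.
End Reduction.

(** * Classification *)

Section Classification.
Variable R : realType.

Lemma iso_dim (g h : sympLie R) : isomorphic g h -> \dim {:g} = \dim {:h}.
Proof.
move=> gh; apply/eqP; rewrite eqn_leq; apply/andP; split.
  by case: gh => phi [/bij_inj/linear_inj_dim].
by case: (isomorphic_sym gh) => phi [/bij_inj/linear_inj_dim].
Qed.

Lemma d_dim (l : vectType R) (a : sympLie R) :
  \dim {:d_car l a} = (\dim {:l} + \dim {:a} + \dim {:l})%N.
Proof. by rewrite -{1}(dim_dual l) !dimvf. Qed.

Lemma nilpotent_rad_center (g : sympLie R) : nilpotent g -> ~ abelian g ->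
  exists2 x : g, rad_center x & x <> 0.
Proof.
move=> /nilpotentP[k gk] gnab.
have [x [y xy0]] : exists x y : g, br x y <> 0.
  apply: contrapT => H; apply: gnab => x y; apply: contrapT => xy.
  by apply: H; exists x, y.
have xyk := gk (br x y).
(* A nonzero bracket that is not central is replaced by a nonzero bracket with it; nilpotency stops
   this at a central one. *)
elim: k x y xy0 xyk {gk gnab} => [|k IHk] x y xy0 xyk; first by [].
have [cxy|] := pselect (center (br x y)).
  by exists (br x y) => //; split=> // z; exact: omega_br_center.
move=> /existsNP[w xyw]; apply: (IHk w (br x y)); last exact: xyk.
by rewrite br_skew => /eqP; rewrite oppr_eq0 => /eqP.
Qed.

Lemma rad_center_model (l : vectType R) (a g : sympLie R)
    (phi : 'Hom(d_car l a, g)) :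
    bijective phi -> (forall x y, omega (phi x) (phi y) = d_omega x y) ->
    (forall x, rad_center x <-> exists Z, x = phi (Z, 0, 0)) ->
    (forall A1 A2, exists Z,
       br (phi (0, A1, 0)) (phi (0, A2, 0)) = phi (Z, br A1 A2, 0)) ->
  exists (z : triple l a) (zZ2 : Z2 z),
    Z2_sharp z /\ isomorphic (d_sympLie zZ2) g.
Proof.
move=> phi_bij phi_om phi_rad phi_br.
have phi_cent Z : center (phi (Z, 0, 0)).
  by have [] : rad_center (phi (Z, 0, 0)) by apply/phi_rad; exists Z.
have [z [zZ2 zE]] := standard_model phi_bij phi_om phi_cent phi_br.
exists z, zZ2.
have phi_iso : @symp_iso _ (d_sympLie zZ2) g phi by [].
split; last by exists phi.
apply/(Z2_sharpP zZ2) => x; rewrite -(rad_center_iso x phi_iso) phi_rad.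
split=> [[Z /(bij_inj phi_bij) ->] //|].
by case: x => [[Z A] L] [/= -> ->]; exists Z.
Qed.

Lemma rad_center_reduction (g : sympLie R) :
  exists (m : nat) (a : sympLie R) (phi : 'Hom(d_car 'rV[R]_m a, g)),
  [/\ bijective phi, forall x y, omega (phi x) (phi y) = d_omega x y,
      forall x, rad_center x <-> exists Z, x = phi (Z, 0, 0) &
      forall A1 A2, exists Z,
        br (phi (0, A1, 0)) (phi (0, A2, 0)) = phi (Z, br A1 A2, 0)].
Proof.
have [j jP] : exists j : {vspace g}, forall x, x \in j <-> rad_center x.
  apply: submod_vspace.
    by split=> y *; rewrite linear0l.
  move=> c x y [cx ox] [cy oy]; split=> [w|w cw].
    by rewrite linearPl /= cx cy scaler0 addr0.
  by rewrite linearPl /= ox // oy // mulr0 addr0.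
have j_iso x y : x \in j -> y \in j -> omega x y = 0.
  by move=> /jP[_ ox] /jP[cy _]; exact: ox.
have [W [psi [psi_bij psi_om psi_j]]] := isotropic_splitting j_iso.
have [|a [phi phi_bij [phi_om phi_j phi_br]]] :=
  symplectic_reduction _ psi_bij psi_om psi_j.
  by move=> x /jP[].
by exists (\dim j), a, phi; split=> // x; rewrite -jP.
Qed.

(** Used to exchange the reduction [a] for its chosen representative [a']: the identification with
    [g] is transported along [u], and a new cocycle is read off from it. *)
Lemma symp_iso_model (l : vectType R) (a a' g : sympLie R) (u : 'Hom(a', a))
    (phi : 'Hom(d_car l a, g)) :
    symp_iso u -> bijective phi ->
    (forall x y, omega (phi x) (phi y) = d_omega x y) ->
    (forall x, rad_center x <-> exists Z, x = phi (Z, 0, 0)) ->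
    (forall A1 A2, exists Z,
       br (phi (0, A1, 0)) (phi (0, A2, 0)) = phi (Z, br A1 A2, 0)) ->
  exists (z : triple l a') (zZ2 : Z2 z),
    Z2_sharp z /\ isomorphic (d_sympLie zZ2) g.
Proof.
move=> u_iso phi_bij phi_om phi_rad phi_br.
have [/[dup] u_bij /linear_bij[uK uVK] u_br u_om] := u_iso.
pose f (x : d_car l a') : g := phi (x.1.1, u x.1.2, x.2).
have lf : linear f.
  move=> k [[Z1 A1] L1] [[Z2 A2] L2]; rewrite /f /= -linearP; congr (phi _).
  by congr (_, _, _); rewrite /= linearP.
have fE Z A L : linfun f (Z, A, L) = phi (Z, u A, L) by rewrite linfun_linE.
apply: (@rad_center_model _ a' _ (linfun f)).
- apply: inj_surj_bij => [[[Z1 A1] L1] [[Z2 A2] L2]|y].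
    by rewrite !fE => /(bij_inj phi_bij)[-> /(can_inj uK) -> ->].
  have [_ phiVK] := linear_bij phi_bij; rewrite -[y]phiVK.
  by case: (phi^-1%VF y) => [[Z A] L]; exists (Z, (u^-1)%VF A, L); rewrite fE uVK.
- by move=> [[Z1 A1] L1] [[Z2 A2] L2]; rewrite !fE phi_om /= u_om.
- by move=> x; rewrite phi_rad; split=> -[Z ->]; exists Z; rewrite fE linear0.
- move=> A1 A2; have [Z ZE] := phi_br (u A1) (u A2); exists Z.
  by rewrite !fE ZE u_br.
Qed.

Variables (n : nat) (A : nat -> sympLie R -> Prop).
Hypothesis A_rep : forall k : nat, representatives (2 * k)%N (A (2 * k)%N).

Lemma dim_rV m : \dim {:'rV[R]_m} = m.
Proof. by rewrite dimvf /dim /= mul1n. Qed.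

Lemma rep_nilp m a : A (2 * n - 2 * m)%N a -> nilp_symp (2 * n - 2 * m) a.
Proof. by rewrite -mulnBr => Aa; have [H _] := A_rep (n - m); exact: H. Qed.

Lemma rep_unique m a a' : A (2 * n - 2 * m)%N a -> A (2 * n - 2 * m)%N a' ->
  isomorphic a a' -> a = a'.
Proof.
rewrite -mulnBr => Aa Aa' aa'; have [A_nilp A_uniq] := A_rep (n - m).
have [b [_ b_uniq]] := A_uniq a (A_nilp a Aa).
by rewrite -(b_uniq a) ?(b_uniq a') //; split=> //; exact: isomorphic_refl.
Qed.

Lemma model_nonabelian_nilp m (a : sympLie R) (z : triple 'rV[R]_m a) (zZ2 : Z2 z) :
  (1 <= m <= n)%N -> A (2 * n - 2 * m)%N a -> Z2_nil z ->
  nonabelian_nilp_class (2 * n) (iso_class (d_sympLie zZ2)).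
Proof.
move=> /andP[m_gt0 m_le] /rep_nilp[a_nilp a_dim] [z_sharp [N N_gt0 xiN]].
exists (d_sympLie zZ2); split=> //.
  split.
    apply/d_nilpotentP; split=> //; exists N => s B sN.
    by rewrite -(xiN (Tuple (introT eqP sN)) B).
  rewrite [LHS]d_dim a_dim dim_rV -addnA addnC -addnA addnn -mul2n subnK //.
  by rewrite leq_mul2l.
(* If all brackets vanished, condition (a) with A = 0 would apply to every L and force l = 0,
   against m >= 1. *)
move=> d_ab; have [_ Ha _] := z_sharp.
have L0 (L : 'rV[R]_m) : L = 0.
  apply: Ha; exists 0; apply/(d_centerP zZ2 0) => y; exact: d_ab.
have := dim_rV m; have -> : fullv = 0%VS :> {vspace 'rV[R]_m}.
  by apply/eqP; rewrite -subv0; apply/subvP => L _; rewrite (L0 L) mem0v.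
by rewrite dimv0 => m0; rewrite -m0 in m_gt0.
Qed.

Lemma model_exists (g : sympLie R) : nilp_symp (2 * n) g -> ~ abelian g ->
  exists m (a : sympLie R) (z : triple 'rV[R]_m a) (zZ2 : Z2 z),
  [/\ (1 <= m <= n)%N, A (2 * n - 2 * m)%N a, Z2_nil z &
      isomorphic (d_sympLie zZ2) g].
Proof.
move=> [g_nilp g_dim] g_nab.
have [m [a [phi [phi_bij phi_om phi_rad phi_br]]]] := rad_center_reduction g.
(* This cocycle over the reduction itself only yields the dimension and nilpotency of [a], which are
   needed to select the representative. *)
have [z [zZ2 [z_sharp z_iso]]] := rad_center_model phi_bij phi_om phi_rad phi_br.
have m_gt0 : (0 < m)%N.
  rewrite lt0n; apply/eqP => m0; 
  have [x /phi_rad[Z ->] Z0] := nilpotent_rad_center g_nilp g_nab.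
  case: Z0; suff -> : Z = 0 by rewrite linear0.
  by apply/lfunP => L; rewrite zero_lfunE; move: (L) Z; rewrite m0 => L' Z;
    rewrite thinmx0 linear0.
have dimE : (2 * m + \dim {:a})%N = (2 * n)%N.
  rewrite -g_dim -(iso_dim z_iso) [RHS]d_dim dim_rV mul2n -addnn; ring.
have m_le : (m <= n)%N by rewrite -(leq_pmul2l (isT : (0 < 2)%N)) -dimE leq_addr.
have dim_a : \dim {:a} = (2 * (n - m))%N by rewrite mulnBr -dimE addKn.
have [a_nilp _] := (d_nilpotentP zZ2).1 (nilpotent_iso (isomorphic_sym z_iso) g_nilp).
have [a' [[Aa' a'_iso] _]] := (A_rep (n - m)).2 a (conj a_nilp dim_a).
have [u u_iso] := isomorphic_sym a'_iso.
have [z' [z'Z2 [z'_sharp z'_iso]]] := symp_iso_model u_iso phi_bij phi_om phi_rad phi_br.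
exists m, a', z', z'Z2; split=> //; [by rewrite m_gt0|by rewrite -mulnBr|split=> //].
have [_ [N xiN]] := (d_nilpotentP z'Z2).1 (nilpotent_iso (isomorphic_sym z'_iso) g_nilp).
(* [Z2_nil] asks for words of positive length; the additional letter acts last, on zero. *)
exists N.+1 => // s B; case/tupleP: s => L s.
by rewrite /= xiN ?size_tuple // (Z2_0E z'Z2).
Qed.

End Classification.

Theorem theorem8 (R : realType) (n : nat) (n_ge1 : (1 <= n)%N)
    (A : nat -> sympLie R -> Prop)
    (A_rep : forall k : nat, representatives (2 * k)%N (A (2 * k)%N)) :
  exists Phi : classification_data n A ->
      {C : sympLie R -> Prop | nonabelian_nilp_class (2 * n)%N C},
    bijective Phi /\
    forall (m : {m : nat | (1 <= m <= n)%N})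
        (a : {a : sympLie R | A (2 * n - 2 * sval m)%N a})
        (c : set_type (H2_nil_mod_G 'rV[R]_(sval m) (sval a)))
        (z : triple 'rV[R]_(sval m) (sval a)) (zZ2 : Z2 z),
      Z2_nil z -> sval c = G_orbit (H2_class z) ->
      sval (Phi (existT _ m (existT _ a c))) = iso_class (d_sympLie zZ2).
Proof.
have nilZ2 (l : vectType R) (a : sympLie R) (z : triple l a) :
  Z2_nil z -> Z2 z by case=> -[].
have repr m (a : {a : sympLie R | A (2 * n - 2 * m)%N a})
    (c : set_type (H2_nil_mod_G 'rV[R]_m (sval a))) :
    exists2 z, Z2_nil z & sval c = G_orbit (H2_class z).
  by have /set_mem[_ [z zN <-] <-] := valP c; exists z.
(* The value is specified for all representatives of the orbit at once, so independence of the
   representative is settled before [Phi] is chosen. *)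
have /choice[Phi PhiE] (x : classification_data n A) :
    exists C : {C : sympLie R -> Prop | nonabelian_nilp_class (2 * n)%N C},
    forall z (zZ2 : Z2 z), Z2_nil z ->
      sval (projT2 (projT2 x)) = G_orbit (H2_class z) ->
      sval C = iso_class (d_sympLie zZ2).
  case: x => [[m m_n] [[a Aa] c]] /=.
  have [z zN cE] := repr m (exist _ a Aa) c; have zZ2 := nilZ2 _ _ _ zN.
  exists (exist _ _ (model_nonabelian_nilp A_rep zZ2 m_n Aa zN)) => w wZ2 wN.
  rewrite cE /= => /(G_orbit_eqP zZ2 wZ2) zw.
  by apply/iso_class_eqP; exact: flag_iso_isomorphic.
exists Phi; split; last by move=> m a c z zZ2 zN cE;
  exact: (PhiE (existT _ m (existT _ a c)) z zZ2 zN cE).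
apply: inj_surj_bij.
  move=> [[m1 m1_n] [[a1 Aa1] c1]] [[m2 m2_n] [[a2 Aa2] c2]] Phi12.
  have [z1 z1N c1E] := repr m1 (exist _ a1 Aa1) c1.
  have [z2 z2N c2E] := repr m2 (exist _ a2 Aa2) c2.
  have z1Z2 := nilZ2 _ _ _ z1N; have z2Z2 := nilZ2 _ _ _ z2N.
  have [[s1 _] [s2 _]] := (z1N, z2N).
  have iso12 : isomorphic (d_sympLie z1Z2) (d_sympLie z2Z2).
    have E1 :=
      PhiE (existT _ (exist _ m1 m1_n) (existT _ (exist _ a1 Aa1) c1)) z1 z1Z2 z1N c1E.
    have E2 :=
      PhiE (existT _ (exist _ m2 m2_n) (existT _ (exist _ a2 Aa2) c2)) z2 z2Z2 z2N c2E.
    by apply/iso_class_eqP; rewrite -E1 -E2 Phi12.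
  (* The indices are matched from the outside in: m through the dimension of l^*, then [a] through
     the induced map on the middle, then the orbit. Each substitution makes the next equation well
     typed. *)
  have m12 : m1 = m2.
    apply/eqP; rewrite eqn_leq -(dim_rV R m1) -(dim_rV R m2) (d_iso_dim s1 s2 iso12).
    exact: d_iso_dim s2 s1 (isomorphic_sym iso12).
  subst m2; have m_irr : m1_n = m2_n by exact: bool_irrelevance.
  subst m2_n.
  have a12 : a1 = a2.
    have [_ dim1] := rep_nilp A_rep Aa1; have [_ dim2] := rep_nilp A_rep Aa2.
    have iso_a : isomorphic a1 a2.
      by apply: d_iso_middle s1 s2 _ iso12; rewrite /= dim1 dim2.
    exact (rep_unique A_rep Aa1 Aa2 iso_a).
  subst a2; have A_irr : Aa1 = Aa2 by exact: Prop_irrelevance.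
  subst Aa2; do 2 congr existT; apply: val_inj; rewrite /= c1E c2E.
  by apply/(G_orbit_eqP z1Z2 z2Z2); exact: isomorphic_flag_iso iso12.
move=> [C C_class]; have [g [g_nilp g_nab CE]] := C_class.
have [m [a [z [zZ2 [m_n Aa zN z_iso]]]]] := model_exists A_rep g_nilp g_nab.
have c_in : G_orbit (H2_class z) \in H2_nil_mod_G 'rV[R]_m a.
  by apply/mem_set; exists (H2_class z) => //; exists z.
pose c : set_type (H2_nil_mod_G 'rV[R]_m a) := exist (fun o => o \in _) _ c_in.
pose x : classification_data n A := existT _ (exist _ m m_n) (existT _ (exist _ a Aa) c).
exists x; move: (PhiE x z zZ2 zN erefl).
case: (Phi x) => C' C'_class /= C'E; apply: eq_exist.
by rewrite C'E CE; apply/iso_class_eqP.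
Qed.
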